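(* Let $d\ge 4$ and let $(V,E)$ be the Cayley tree of order $d$. Then there exist finite constants $\beta_b(d)>0$ and $\lambda_b(d)>0$ such that for every $\beta>\beta_b(d)$ there is a finite time $t_b(\beta,d)$ such that for all $t\ge t_b(\beta,d)$ and all $\lambda\ge\lambda_b(d)$ the set of bad configurations for the time-evolved intermediate measure $\mu^{\#}_{\beta,\lambda,t}$ has full measure, i.e. $\mu^{\#}_{\beta,\lambda,t}(\{\eta\in\Omega:\eta\text{ is bad for }\mu^{\#}_{\beta,\lambda,t}\})=1$.
   Context: The Cayley tree of order $d$ is the infinite tree $(V,E)$ in which each vertex has exactly $d+1$ neighbours. $\Omega=\{-1,0,1\}^V$ carries the product $\sigma$-algebra and product topology; $\sigma_\Lambda$ denotes the restriction map $\omega\mapsto\omega_\Lambda=(\omega_i)_{i\in\Lambda}$, $\mathcal F_\Lambda$ the $\sigma$-algebra generated by $\sigma_\Lambda$, and $\Lambda\Subset V$ means $\Lambda$ is a finite subset. A site $i$ is occupied in $\omega$ if $|\omega_i|=1$. A function is local if it is $\mathcal F_\Lambda$-measurable for some $\Lambda\Subset V$. Soft-core Widom-Rowlinson model (zero magnetic field), $\beta>0$ (repulsion), $\lambda>0$ (activity): for $\Lambda\Subset V$, $$\gamma_\Lambda(\sigma_\Lambda=\omega_\Lambda\mid\eta_{\Lambda^c})=\frac1{Z_\Lambda(\eta_{\Lambda^c})}\exp\Big(-\beta\sum_{\{i,j\}\in E,\{i,j\}\cap\Lambda\ne\emptyset}1_{\{\tilde\omega_i\tilde\omega_j=-1\}}\Big)\prod_{i\in\Lambda}\lambda^{\omega_i^2},\qquad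 \tilde\omega=\omega_\Lambda\eta_{\Lambda^c}.$$ Gibbs measures of the model are probability measures $\mu$ with $\mu=\mu\gamma_\Lambda$ for all $\Lambda\Subset V$. A probability measure $\mu$ on $\Omega$ is a tree-indexed Markov chain if for each oriented edge $ij$ one has $\mu(\sigma_j=x\mid\mathcal F_{(-\infty,ij)})=\mu(\sigma_j=x\mid\mathcal F_{\{i\}})$ $\mu$-a.s. for all $x$, where $(-\infty,ij)$ is the set of vertices $k$ whose self-avoiding path to $i$ does not contain $j$. The intermediate measure $\mu^{\#}_{\beta,\lambda}$ is the unique Gibbs measure of the model that is a tree-indexed Markov chain, invariant under all tree automorphisms, and invariant under the spin flip $\omega\mapsto-\omega$. Concretely, let $\xi=\xi_{\beta,\lambda}$ be the unique positive solution of $x=\lambda\big(\frac{1+(1+e^{-\beta})x}{1+2x}\big)^d$; then $\mu^{\#}_{\beta,\lambda}$ is the homogeneous tree-indexed Markov chain with transition matrix $P$ given by $P(s,s)=\frac{\xi}{1+(1+e^{-\beta})\xi}$, $P(s,-s)=\frac{e^{-\beta}\xi}{1+(1+e^{-\beta})\xi}$, $P(s,0)=\frac{1}{1+(1+e^{-\beta})\xi}$ for $s\in\{-1,1\}$, $P(0,\pm1)=\frac{\xi}{1+2\xi}$, $P(0,0)=\frac1{1+2\xi}$, with the $P$-invariant distribution as single-site marginal. Time evolution: for $t\ge0$, $\mu_t$ is the image of $\mu$ under the product kernel that acts independently at each site by $$p_t(\omega,\eta)=\tfrac12(1+e^{-2t})1_{\{\omega=\eta\ne0\}}+\tfrac12(1-e^{-2t})1_{\{\omega\eta=-1\}}+1_{\{\omega=\eta=0\}},\qquad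 \omega,\eta\in\{-1,0,1\}.$$ $\mu^{\#}_{\beta,\lambda,t}$ is the time-evolved measure started from $\mu^{\#}_{\beta,\lambda}$. Bad configurations: a measure $\mu_t$ is essentially-discontinuous at $\eta\in\Omega$, and $\eta$ is then called bad for $\mu_t$, if there exist a local function $f$ and $\Lambda_0\Subset V$ such that $$\limsup_{\Lambda\nearrow V}\ \sup_{\xi^1,\xi^2\in\Omega,\ \Delta:\Lambda\subset\Delta\Subset V}\big|\mu_t(f\mid\eta_{\Lambda\setminus\Lambda_0}\xi^1_{\Delta\setminus\Lambda})-\mu_t(f\mid\eta_{\Lambda\setminus\Lambda_0}\xi^2_{\Delta\setminus\Lambda})\big|>0,$$ where $\mu_t(f\mid\zeta_A)$ is the elementary conditional expectation of $f$ given $\{\sigma_A=\zeta_A\}$ and the limsup is along finite $\Lambda$ directed by inclusion. Configurations that are not bad are good. *)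

(* Defs.v *)
From HB Require Import structures.
From mathcomp Require Import all_boot all_order all_algebra finmap.
From mathcomp Require Import all_classical all_reals all_analysis.

Set Implicit Arguments.
Unset Strict Implicit.
Unset Printing Implicit Defensive.

Import Order.TTheory GRing.Theory Num.Theory.

Local Open Scope classical_set_scope.
Local Open Scope ring_scope.

Inductive spin := Minus | Zero | Plus.

Definition spin_val (s : spin) : int :=
  match s with Minus => -1 | Zero => 0 | Plus => 1 end.

Definition spin_opp (s : spin) : spin :=
  match s with Minus => Plus | Zero => Zero | Plus => Minus end.

Definition spin_code (s : spin) : option bool :=
  match s with Minus => Some false | Zero => None | Plus => Some true end.

Definition spin_decode (c : option bool) : spin :=
  match c with Some false => Minus | None => Zero | Some true => Plus end.

Lemma spin_codeK : cancel spin_code spin_decode. Proof. by case. Qed.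

HB.instance Definition _ := Finite.copy spin (can_type spin_codeK).
HB.instance Definition _ := isPointed.Build spin Zero.

(* A graph on V is given by its set E of edges, unordered pairs of vertices. *)
Section Graph.
Variable V : choiceType.
Implicit Types (E : set {fset V}) (i j k : V).

Definition adj E : rel V := fun i j => [fset i; j]%fset \in E.

(* Repeated consecutive vertices are impossible since edges have two elements,
   and the cycles with two vertices are those that traverse one edge twice. *)
Definition is_tree E :=
  [/\ forall e, E e -> #|` e| = 2%N,
      forall i j, exists2 p, path (adj E) i p & last i p = j
    & forall c, ucycle (adj E) c -> (size c <= 2)%N].

Definition cayley_tree (d : nat) E :=
  [/\ infinite_set [set: V], is_tree E
    & forall i, ([set j | adj E i j] #= `I_d.+1)%card].

(* The past (-oo, ij): the self-avoiding path from k to i avoids j. *)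
Definition past E i j : set V :=
  [set k | exists p, [/\ path (adj E) k p, last k p = i, uniq (k :: p)
                       & j \notin k :: p]].

Definition automorphism E (phi : V -> V) :=
  bijective phi /\ forall i j, adj E (phi i) (phi j) = adj E i j.

End Graph.

Section Configurations.
Variable V : choiceType.
Implicit Types (S : set V) (L : {fset V}).

Definition cylinders S : set (set (V -> spin)) :=
  [set A | exists2 i, S i & exists s, A = [set w | w i = s]].

(* The sample space, with the product sigma-algebra. *)
Definition Omega := g_sigma_algebraType (cylinders setT).

(* The sample space, with the sigma-algebra F_S generated by (w_i)_{i in S}. *)
Definition Omega_on S := g_sigma_algebraType (cylinders S).

(* The event {sigma_L = z_L}. *)
Definition agree L (z : V -> spin) : set Omega :=
  [set w | forall i, i \in L -> w i = z i].

(* w on L and z elsewhere. *)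
Definition splice L (w z : V -> spin) : V -> spin :=
  fun i => if i \in L then w i else z i.

(* The same, with w given on L only. *)
Definition glue L (w : {ffun L -> spin}) (z : V -> spin) : V -> spin :=
  fun i => if insub i is Some k then w k else z i.

Definition local (R : realType) (f : Omega -> R) :=
  exists L : {fset V},
    measurable_fun [set: Omega_on [set` L]] (f : Omega_on [set` L] -> R).

End Configurations.

Section WidomRowlinson.
Variables (R : realType) (V : choiceType) (E : set {fset V}) (beta la : R).
Implicit Types (L : {fset V}) (mu : probability (Omega V) R).

Definition n_conflicts L (w : V -> spin) : R :=
  \sum_(e \in [set e | E e /\ (e `&` L != fset0)%fset])
     ((\prod_(i <- e) spin_val (w i) == -1)%:R : R).

(* The exponent of la is (w_i)^2. *)
Definition weight L (w : V -> spin) : R :=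
  expR (- beta * n_conflicts L w) *
  \prod_(i <- L) la ^+ (w i != Zero).

Definition partition_fun L (z : V -> spin) : R :=
  \sum_(w : {ffun L -> spin}) weight L (glue w z).

Definition gamma L (z : V -> spin) (w : {ffun L -> spin}) : R :=
  weight L (glue w z) / partition_fun L z.

Definition gamma_kernel L (z : V -> spin) (A : set (Omega V)) : \bar R :=
  (\sum_(w : {ffun L -> spin}) gamma z w * \1_A (glue w z))%:E.

Definition gibbs mu :=
  forall L (A : set (Omega V)), measurable A ->
    mu A = (\int[mu]_z gamma_kernel L z A)%E.

(* g is a version of the conditional probability mu(A | F_S). *)
Definition cond_prob_version mu (S : set V) (A : set (Omega V))
    (g : Omega V -> R) :=
  [/\ measurable_fun [set: Omega_on S] (g : Omega_on S -> R),
      mu.-integrable setT (EFin \o g)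
    & forall B : set (Omega_on S), measurable B ->
        (\int[mu]_(w in B) (g w)%:E)%E = mu (A `&` B)].

Definition tree_markov_chain mu :=
  forall i j, adj E i j -> forall s : spin,
    exists g1 g2 : Omega V -> R,
      [/\ cond_prob_version mu (past E i j) [set w | w j = s] g1,
          cond_prob_version mu [set i] [set w | w j = s] g2
        & {ae mu, forall w, g1 w = g2 w}].

Definition automorphism_invariant mu :=
  forall phi, automorphism E phi ->
    forall A : set (Omega V), measurable A ->
      mu [set w : Omega V | A (w \o phi)] = mu A.

Definition flip_invariant mu :=
  forall A : set (Omega V), measurable A ->
    mu [set w : Omega V | A (spin_opp \o w)] = mu A.

(* On a Cayley tree, for beta, la > 0, exactly one measure is intermediate. *)
Definition intermediate mu :=
  [/\ gibbs mu, tree_markov_chain mu, automorphism_invariant mu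
    & flip_invariant mu].

End WidomRowlinson.

Section TimeEvolution.
Variables (R : realType) (V : choiceType).

Definition p_site (t : R) (a b : spin) : R :=
  2^-1 * (1 + expR (- (2 * t))) * ((a == b) && (b != Zero))%:R +
  2^-1 * (1 - expR (- (2 * t))) * (spin_val a * spin_val b == -1)%:R +
  ((a == Zero) && (b == Zero))%:R.

(* Cylinder probabilities determine the product kernel uniquely. *)
Definition product_kernel (t : R) (K : R.-pker Omega V ~> Omega V) :=
  forall (w : Omega V) (L : {fset V}) (z : V -> spin),
    K w (agree L z) = (\prod_(i <- L) p_site t (w i) (z i))%:E.

Definition time_evolved (t : R) (mu mut : probability (Omega V) R) :=
  exists2 K : R.-pker Omega V ~> Omega V, product_kernel t K &
    forall A : set (Omega V), measurable A ->
      mut A = (\int[mu]_w K w A)%E.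

End TimeEvolution.

Section BadConfigurations.
Variables (R : realType) (V : choiceType) (nu : probability (Omega V) R).

Definition cond_mean (f : Omega V -> R) (A : set (Omega V)) : R :=
  Rintegral nu A f / fine (nu A).

(* nu(f | eta_{L \ L0} xi_{D \ L}) *)
Definition cond_mean_at (f : Omega V -> R) (L0 L D : {fset V})
    (eta xi : V -> spin) : R :=
  cond_mean f (agree ((L `\` L0) `|` (D `\` L))%fset (splice L eta xi)).

Definition oscillation (f : Omega V -> R) (L0 : {fset V}) (eta : V -> spin)
    (L : {fset V}) : \bar R :=
  ereal_sup [set x | exists (xi1 xi2 : V -> spin) (D : {fset V}),
    (L `<=` D)%fset /\
    x = `|cond_mean_at f L0 L D eta xi1 - cond_mean_at f L0 L D eta xi2|%:E].

(* The limsup along the finite sets of vertices directed by inclusion. *)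
Definition limsup_fset (g : {fset V} -> \bar R) : \bar R :=
  ereal_inf [set ereal_sup [set g L | L in [set L | (L1 `<=` L)%fset]]
            | L1 in [set: {fset V}]].

Definition bad (eta : Omega V) :=
  exists (f : Omega V -> R) (L0 : {fset V}),
    local f /\ (0 < limsup_fset (oscillation f L0 eta))%E.

End BadConfigurations.

(* Main.v *)
Require Import Defs.
From HB Require Import structures.
From mathcomp Require Import all_boot all_order all_algebra finmap.
From mathcomp Require Import all_classical all_reals all_analysis.
From mathcomp Require Import measurable_realfun zify ring lra.

(* Given the set of occupied sites, which the time evolution preserves, the
   initial measure is an Ising model whose spins are joined along occupied
   edges, and the evolved configuration acts on it as a field of size
   log ((1 + e^(-2t)) / (1 - e^(-2t))), small for large t.  With E = e^beta, a
   child whose likelihood ratio P(evolved configuration below | +) /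
   P(... | -) is rho multiplies that of its parent by (rho E + 1) / (rho + E),
   which always lies in [1/E, E].  If rho >= E for all but one of the d >= 4
   children, the parent's ratio is again at least E, whatever the fields and
   the exceptional child do.  So along an occupied subtree in which every
   vertex has at least d - 1 good children, a boundary condition + (or -) far
   away still determines the conditional law at the root.  Such subtrees are
   started inside the annulus occupied by the boundary condition, where even
   a tiny homogeneous field drives the ratio from 1 to E.

   For large activity a site is vacant with conditional probability at most
   eps = 2^d / lambda given the past.  The probability that no good subtree
   of depth n hangs below a vertex then stays below 2 eps by induction on n,
   and independence over branches makes it almost sure that some vertex is the
   root of an infinite one. *)

Set Implicit Arguments.
Unset Strict Implicit.
Unset Printing Implicit Defensive.

Import Order.TTheory GRing.Theory Num.Theory.

Local Open Scope classical_set_scope.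
Local Open Scope ring_scope.

(** * The tree *)

Section CayleyTree.
Variables (V : choiceType) (d : nat) (E : set {fset V}).
Hypothesis cayleyE : cayley_tree d E.
Implicit Types (i j k u v : V) (n m : nat).

(** [fset_set] returns the empty set on infinite arguments; [cayley_tree] supplies the finiteness,
    see [mem_nbr]. *)
Definition nbr j : seq V := fset_set [set k | adj E j k].

Definition children i j : seq V := [seq k <- nbr j | k != i].

Lemma adjC i j : adj E i j = adj E j i.
Proof. by rewrite /adj fsetUC. Qed.

Lemma adj_neq i j : adj E i j -> i != j.
Proof.
case: cayleyE => _ [Ecard _ _] _ /set_mem /Ecard.
by rewrite cardfs2; case: eqP.
Qed.

Lemma mem_nbr j k : (k \in nbr j) = adj E j k.
Proof.
case: cayleyE => _ _ /(_ j) Nj.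
have fin : finite_set [set k | adj E j k] by exists d.+1.
by rewrite in_fset_set //; apply/idP/idP => [/set_mem//|?]; exact/mem_set.
Qed.

Lemma uniq_nbr j : uniq (nbr j).
Proof. exact: fset_uniq. Qed.

Lemma size_nbr j : size (nbr j) = d.+1.
Proof.
case: cayleyE => _ _ /(_ j) Nj.
have fin : finite_set [set k | adj E j k] by exists d.+1.
by apply/card_eq_fsetP; rewrite fset_setK.
Qed.

Lemma mem_children i j k : (k \in children i j) = adj E j k && (k != i).
Proof. by rewrite mem_filter mem_nbr andbC. Qed.

Lemma uniq_children i j : uniq (children i j).
Proof. exact/filter_uniq/uniq_nbr. Qed.

Lemma perm_nbr i j : adj E i j -> perm_eq (nbr j) (i :: children i j).
Proof.
move=> ij; have ji : i \in nbr j by rewrite mem_nbr adjC.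
apply: perm_trans (perm_to_rem ji) _; rewrite perm_cons /children.
by rewrite rem_filter ?uniq_nbr.
Qed.

Lemma size_children i j : adj E i j -> size (children i j) = d.
Proof. by move=> /perm_nbr/perm_size; rewrite size_nbr => -[]. Qed.

Lemma past_self i j : adj E i j -> past E i j i.
Proof.
by move=> ij; exists [::]; split => //; rewrite inE eq_sym adj_neq.
Qed.

(** Append [j] to the self-avoiding path. If that path met [k], its part from [k] to [i] followed by
    [j] would close a cycle, with at least three vertices since [k != i]. *)
Lemma past_step i j k : adj E i j -> adj E j k -> k != i ->
  past E i j `<=` past E j k.
Proof.
case: cayleyE => _ [_ _ acyclic] _ ij jk ki v [p [vp lp up jp]].
exists (rcons p j); split; rewrite ?last_rcons //.
- by rewrite rcons_path vp lp.
- by rewrite -rcons_cons rcons_uniq jp.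
rewrite -rcons_cons mem_rcons inE negb_or eq_sym adj_neq //=.
apply/negP => kp; case/splitPl: kp vp lp up jp => p1 p2 kE.
rewrite cat_path last_cat -cat_cons cat_uniq mem_cat.
move=> /andP[_ pp2] lp2 /and3P[_ disj up2] /norP[jp1 jp2].
rewrite kE in pp2 lp2.
have kp2 : k \notin p2.
  apply: contra disj => kp2; apply/hasP; exists k => //.
  by rewrite -kE mem_last.
have /acyclic : ucycle (adj E) (k :: rcons p2 j).
  apply/andP; split.
    by rewrite /= !rcons_path last_rcons pp2 lp2 ij jk.
  rewrite /= mem_rcons inE rcons_uniq negb_or kp2 up2 jp2 !andbT.
  by rewrite eq_sym adj_neq.
rewrite /= size_rcons; case: p2 lp2 {pp2 disj up2 jp2 kp2} => //= kE' _.
by rewrite kE' eqxx in ki.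
Qed.

Lemma past_disjoint i j v : adj E i j -> past E i j v -> past E j i v -> False.
Proof.
case: cayleyE => _ [_ _ acyclic] _ ij [p [vp lp up jp]] [q [vq lq uq iq]].
(* A walk from i to j via v avoids the edge ij, hence closes up to a cycle. *)
pose e x y := adj E x y && ([fset x; y]%fset != [fset i; j]%fset).
have eC : symmetric e by move=> x y; rewrite /e adjC fsetUC.
have avoid z x s : z \in [fset i; j]%fset -> path (adj E) x s ->
    z \notin x :: s -> path e x s.
  move=> zij; elim: s x => //= y s IHs x /andP[xy ys].
  rewrite inE => /norP[zx zys].
  rewrite /e xy IHs //= andbT; apply: contra zys => /eqP xyij.
  by move: zij; rewrite -xyij !inE (negPf zx) /= => ->.
have ep : path e v p by apply: (@avoid j); rewrite // !inE eqxx orbT.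
have eq : path e v q by apply: (@avoid i); rewrite // !inE eqxx.
pose s := rev (belast v p) ++ q.
have lrev : last i (rev (belast v p)) = v.
  by rewrite -lp; case: (p) => //= x p'; rewrite rev_cons last_rcons.
have es : path e i s.
  rewrite cat_path lrev eq andbT -lp rev_path.
  by rewrite (eq_path (e' := e)) // => x y; rewrite eC.
have ls : last i s = j by rewrite /s last_cat lrev.
case/shortenP: es ls => s' es' us' _ ls'.
have as' : path (adj E) i s' by apply: sub_path es' => x y /andP[].
have /acyclic : ucycle (adj E) (i :: s').
  by apply/andP; split=> //=; rewrite rcons_path as' ls' adjC.
(* Acyclicity leaves [i = j] or the single step along [ij], which [e] excludes. *)
case: s' {us'} as' es' ls' => [|x [|//]] /=.
  by move=> _ _ ji; move: (adj_neq ij); rewrite ji eqxx.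
by move=> _ + xj; rewrite xj /e eqxx andbF.
Qed.

(** No root is fixed: the oriented edge from [i] to [j] tells which side is below, so the balls
    around every vertex decompose into such lists. *)
Fixpoint desc n i j : seq V :=
  j :: if n is n'.+1 then flatten [seq desc n' j k | k <- children i j]
       else [::].

Lemma desc_past n i j v : adj E i j -> v \in desc n i j -> past E j i v.
Proof.
elim: n i j v => [|n IHn] i j v ij /=; rewrite in_cons => /predU1P[->|//].
- by apply: past_self; rewrite adjC.
- by apply: past_self; rewrite adjC.
move=> /flatten_mapP[k]; rewrite mem_children => /andP[jk ki] /IHn kv.
by apply: past_step (kv _) => //; rewrite 1?adjC // eq_sym.
Qed.

(** This makes events on sibling branches admissible as conditions in the Markov property along the
    edge from [j] to [k]. *)
Lemma desc_sibling n j k k' v : adj E j k -> adj E j k' -> k' != k ->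
  v \in desc n j k' -> past E j k v.
Proof.
move=> jk jk' k'k /(desc_past jk'); apply: past_step => //; first by rewrite adjC.
by rewrite eq_sym.
Qed.

Lemma desc_disjoint n i j v : adj E i j -> past E i j v -> v \notin desc n i j.
Proof.
by move=> ij vij; apply/negP => /(desc_past ij); exact: past_disjoint vij.
Qed.

(** Two branches at [j] cannot meet, because they lie on different sides of the edge leading to one
    of them. A general sublist of the neighbours serves both [desc] and [tree_ball]. *)
Lemma uniq_flatten_desc n j s : uniq s -> {subset s <= nbr j} ->
    (forall k, k \in s -> uniq (desc n j k)) ->
  uniq (j :: flatten [seq desc n j k | k <- s]).
Proof.
move=> us sN uD; have adjs k : k \in s -> adj E j k.
  by move=> /sN; rewrite mem_nbr.
rewrite /=; apply/andP; split.
  apply/negP => /flatten_mapP[k ks]; apply/negP/desc_disjoint; rewrite ?adjs//.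
  exact/past_self/adjs.
elim: s us uD adjs {sN} => //= k s IHs /andP[ks us] uD adjs.
have sub (P : V -> Prop) : (forall k', k' \in k :: s -> P k') ->
    forall k', k' \in s -> P k'.
  by move=> H k' k's; apply: H; rewrite inE k's orbT.
rewrite cat_uniq uD ?mem_head // IHs //; [|exact: sub|exact: sub].
rewrite andbT; apply/hasPn => v /flatten_mapP[k' k's vk'].
have k'k : k' != k by apply: contraNneq ks => <-.
apply: desc_disjoint; first exact/adjs/mem_head.
apply: desc_sibling k'k vk'; rewrite adjs ?mem_head //.
by rewrite inE k's orbT.
Qed.

Lemma uniq_desc n i j : uniq (desc n i j).
Proof.
elim: n i j => // n IHn i j; apply: uniq_flatten_desc => //.
  exact: uniq_children.
by move=> k; rewrite mem_filter => /andP[].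
Qed.

Definition tree_ball n u := u :: flatten [seq desc n u k | k <- nbr u].

Lemma uniq_tree_ball n u : uniq (tree_ball n u).
Proof.
by apply: uniq_flatten_desc => // [|k _]; [exact: uniq_nbr|exact: uniq_desc].
Qed.

Lemma desc_sub n m i j : (n <= m)%N -> {subset desc n i j <= desc m i j}.
Proof.
elim: n m i j => [|n IHn] [|m] i j // nm v.
- by [].
- by rewrite mem_seq1 in_cons => ->.
rewrite !in_cons => /orP[->//|/flatten_mapP[k kc kv]]; apply/orP; right.
by apply/flatten_mapP; exists k => //; exact: IHn kv.
Qed.

Lemma tree_ball_sub n m u : (n <= m)%N -> {subset tree_ball n u <= tree_ball m u}.
Proof.
move=> nm v; rewrite !in_cons => /orP[->//|/flatten_mapP[k kc kv]].
by apply/orP; right; apply/flatten_mapP; exists k => //; exact: desc_sub kv.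
Qed.

(** Follow a self-avoiding path from [u]: as it never turns back, each vertex is a child of the
    previous one. *)
Lemma mem_tree_ball u v : exists n, v \in tree_ball n u.
Proof.
case: cayleyE => _ [_ conn _] _; have [p up <-] := conn u v.
case/shortenP: up => -[_ _ _|k q /= /andP[uk kq] /andP[ukq kq'] _].
  by exists 0%N; rewrite mem_head.
exists (size q); rewrite in_cons; apply/orP; right; apply/flatten_mapP.
exists k; rewrite ?mem_nbr //; move: kq => /= kq.
elim: q u k uk kq ukq kq' {p} => [|k' p IHp] u k uk /=; first by rewrite mem_head.
move=> /andP[kk' k'p]; rewrite !inE !negb_or => /and3P[ukN uk' up].
move=> /and3P[/andP[kk'N kpN] k'p' up']; apply/orP; right; apply/flatten_mapP.
exists k'; first by rewrite mem_children kk' eq_sym.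
by apply: IHp; rewrite //= ?inE ?negb_or ?kk'N ?kpN ?k'p' ?up'.
Qed.

Lemma tree_ball_cofinal (L : {fset V}) u : exists n, {subset L <= tree_ball n u}.
Proof.
suff [n Hn] : exists n, {subset (L : seq V) <= tree_ball n u} by exists n.
elim: (L : seq V) => [|v s [n IHn]]; first by exists 0%N.
have [m vm] := mem_tree_ball u v; exists (maxn n m) => w; rewrite inE.
move=> /predU1P[->|/IHn]; first exact: tree_ball_sub (leq_maxr n m) _ vm.
exact: tree_ball_sub (leq_maxl n m) _.
Qed.

Lemma exists_adj : exists i j, adj E i j.
Proof.
case: cayleyE => infV _ _; have [u _] := infinite_setN0 infV.
have := size_nbr u; case Nu: (nbr u) => [//|j s] _.
by exists u, j; rewrite -mem_nbr Nu mem_head.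
Qed.

Lemma countable_vertices : countable [set: V].
Proof.
have [u _] := exists_adj.
have -> : [set: V] = \bigcup_(n in [set: nat]) [set` tree_ball n u].
  by apply/seteqP; split => // v _; have [n vn] := mem_tree_ball u v; exists n.
apply: bigcup_countable => // n _.
exact/finite_set_countable/finite_seq.
Qed.

End CayleyTree.

(** * Sigma-algebras of coordinates and the Markov property *)

Lemma big_spin (T : Type) (idx : T) (op : Monoid.com_law idx) (f : spin -> T) :
  \big[op/idx]_(s : spin) f s = op (f Plus) (op (f Minus) (f Zero)).
Proof.
rewrite (bigD1 Plus) //= (bigD1 Minus) //= (bigD1 Zero) //= big1 ?Monoid.mulm1 //.
by case.
Qed.

Section SigmaAlgebras.
Variable V : choiceType.
Implicit Types (S : set V) (A B : set (V -> spin)) (w : V -> spin) (v : V).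

(** Made of sets of plain functions, so that events of different sub-sigma-algebras share one type
    and can be intersected. *)
Definition F S : set (set (V -> spin)) := <<s cylinders S >>.

Definition at_ v (s : spin) : set (Omega V) := [set w | w v = s].

Lemma F_sub S S' : S `<=` S' -> F S `<=` F S'.
Proof.
by move=> SS'; apply: sub_sigma_algebra2 => A [v /SS' ? ?]; exists v.
Qed.

Lemma F_at S v s : S v -> F S (at_ v s).
Proof. by move=> Sv; apply: sub_sigma_algebra; exists v => //; exists s. Qed.

Lemma F_setI S A B : F S A -> F S B -> F S (A `&` B).
Proof. exact: (@measurableI _ (Omega_on S)). Qed.

Lemma F_setU S A B : F S A -> F S B -> F S (A `|` B).
Proof. exact: (@measurableU _ (Omega_on S)). Qed.

Lemma F_set0 S : F S set0.
Proof. exact: (@measurable0 _ (Omega_on S)). Qed.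

Lemma F_setT S : F S setT.
Proof. exact: (@measurableT _ (Omega_on S)). Qed.

Lemma F_bigcup S (A : nat -> set (V -> spin)) :
  (forall n, F S (A n)) -> F S (\bigcup_n A n).
Proof. by move=> FA; apply: (@bigcupT_measurable _ (Omega_on S)). Qed.

Lemma F_measurable S A : F S A -> measurable (A : set (Omega V)).
Proof. exact: F_sub. Qed.

Lemma measurable_at v s : measurable (at_ v s).
Proof. by apply: (@F_measurable setT); exact: F_at. Qed.

(** The sets that depend only on the coordinates in [S] form a sigma-algebra containing the
    cylinders. *)
Lemma F_determined S A : F S A ->
  forall w w', (forall v, S v -> w v = w' v) -> A w <-> A w'.
Proof.
move: A; apply: smallest_sub => [|A [v Sv [s ->]] w w' ww' /=]; last by rewrite ww'.
split=> [//|A DA w w' ww'|A DA w w' ww'] /=.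
- by split=> -[_ nA]; split=> //; apply: contra_not nA; rewrite (DA w w').
- by split=> -[n _ An]; exists n => //; [rewrite -(DA n w w')|rewrite (DA n w w')].
Qed.

Definition upd w v s : V -> spin := fun u => if u == v then s else w u.

(** A converse for finitely many coordinates: slice by the value at one site and freeze that value
    with [upd]. *)
Lemma determined_F S (r : seq V) A : (forall v, v \in r -> S v) ->
  (forall w w', {in r, w =1 w'} -> A w -> A w') -> F S A.
Proof.
elim: r A => [|v r IHr] A Sr DA.
  have [[w Aw]|nA] := pselect (exists w, A w); last first.
    rewrite (_ : A = set0) -?subset0 //; first exact: F_set0.
    by move=> w Aw; apply: nA; exists w.
  suff -> : A = setT by exact: F_setT.
  by apply/seteqP; split => // w' _; apply: DA Aw.
have -> : A = \bigcup_(s in setT) (at_ v s `&` [set w | A (upd w v s)]).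
  apply/seteqP; split => [w Aw|w [s _ [<-]]].
    exists (w v) => //; split=> //=; apply: DA Aw => u _.
    by rewrite /upd; case: eqP => [->|].
  by apply: DA => u _; rewrite /upd; case: eqP => [->|].
apply: (@fin_bigcup_measurable _ (Omega_on S)) => // s _.
apply: F_setI; first by apply: F_at; apply: Sr; rewrite mem_head.
apply: IHr => [u ur|w w' ww']; first by apply: Sr; rewrite inE ur orbT.
apply: DA => u; rewrite /upd inE => /orP[->//|/ww' ->//].
Qed.

End SigmaAlgebras.

Section RealProbability.
Variables (V : choiceType) (R : realType) (mu : probability (Omega V) R).
Implicit Types (A B : set (Omega V)).

Definition pr B : R := fine (mu B).

Lemma prE B : measurable B -> mu B = (pr B)%:E.
Proof. by move=> mB; rewrite fineK // fin_num_measure. Qed.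

Lemma pr_ge0 B : 0 <= pr B.
Proof. exact/fine_ge0/measure_ge0. Qed.

Lemma le_pr A B : measurable A -> measurable B -> A `<=` B -> pr A <= pr B.
Proof.
by move=> mA mB AB; rewrite -lee_fin -!prE //; apply: le_measure; rewrite ?inE.
Qed.

Lemma pr_setT : pr setT = 1.
Proof. by rewrite /pr probability_setT. Qed.

Lemma prU A B : measurable A -> measurable B -> A `&` B = set0 ->
  pr (A `|` B) = pr A + pr B.
Proof.
move=> mA mB AB0; apply: EFin_inj; rewrite EFinD -!prE //; last exact: measurableU.
exact: measureU.
Qed.

Lemma prU_le A B : measurable A -> measurable B ->
  pr (A `|` B) <= pr A + pr B.
Proof.
move=> mA mB; rewrite -lee_fin EFinD -!prE //; last exact: measurableU.
exact: measureU2.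
Qed.

Lemma pr_split v B : measurable B -> pr B = \sum_(s : spin) pr (B `&` at_ v s).
Proof.
move=> mB; rewrite big_spin.
have mI s : measurable (B `&` at_ v s).
  by apply: measurableI => //; exact: measurable_at.
rewrite -[LHS]/(pr B) -[in LHS](@setIT _ B).
have -> : [set: Omega V] = at_ v Plus `|` (at_ v Minus `|` at_ v Zero).
  apply/seteqP; split=> // w _; rewrite /at_ /=.
  by case: (w v); [right; left|right; right|left].
rewrite !setIUr prU //; [congr (_ + _); rewrite prU //|exact: measurableU|].
- by rewrite -subset0 => w [[_ +] [_]]; rewrite /at_ /= => ->.
- by rewrite -subset0 => w [[_ +] [[_]|[_]]]; rewrite /at_ /= => ->.
Qed.

End RealProbability.

Section Markov.
Variables (V : choiceType) (E : set {fset V}) (R : realType).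
Variable mu : probability (Omega V) R.
Hypothesis mk : tree_markov_chain E mu.
Implicit Types (i j : V) (a s : spin).

Definition trans i j a s : R := pr mu (at_ i a `&` at_ j s) / pr mu (at_ i a).

(** The version given [F [set i]] is constant on [at_ i a]. Integrating it over [at_ i a] identifies
    the constant as [trans i j a s], and integrating over [B] gives the claim. *)
Lemma markov_step i j a s B : adj E i j -> 0 < pr mu (at_ i a) ->
  past E i j i -> F (past E i j) B -> B `<=` at_ i a ->
  pr mu (B `&` at_ j s) = trans i j a s * pr mu B.
Proof.
move=> ij pos iij FB Bi.
have [g1 [g2 [[mg1 ig1 g1E] [mg2 ig2 g2E] g12]]] := mk ij s.
have mB := F_measurable FB.
have [c cE] : exists c, forall w : V -> spin, w i = a -> g2 w = c.
  have [[w0 w0i]|] := pselect (exists w0 : V -> spin, w0 i = a); last first.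
    by move=> nw; exists 0 => w wi; case: nw; exists w.
  exists (g2 w0) => w wi.
  have := mg2 measurableT [set g2 w0] (measurable_set1 _); rewrite setTI => Fg.
  have /(_ w0 w) := @F_determined V [set i] _ Fg.
  by case=> [v ->|+ _]; [rewrite w0i wi|apply].
have intc (C : set (Omega V)) : measurable C -> C `<=` at_ i a ->
    (\int[mu]_(w in C) (g2 w)%:E = (c * pr mu C)%:E)%E.
  move=> mC Ci; rewrite EFinM -prE // -integral_cst //.
  by apply: eq_integral => w /set_mem/Ci wi; rewrite cE.
have ma := @measurable_at V i a.
have := g2E (at_ i a) (@F_at V [set i] i a erefl).
have := g1E B FB.
rewrite intc // (ae_eq_integral (EFin \o g2)) //; first last.
- by apply: filterS g12 => w /= -> _.
- by apply: measurable_funS (measurable_int _ ig2).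
- by apply: measurable_funS (measurable_int _ ig1).
have mjs := @measurable_at V j s.
rewrite intc // [_ `&` B]setIC [_ `&` at_ i a]setIC /=.
rewrite -[[set w | w j = s]]/(at_ j s).
rewrite !prE; do ?exact: measurableI.
by move=> [<-] [ce]; rewrite /trans -ce mulfK // gt_eqF.
Qed.

End Markov.

(** * Gibbs ratios at a single site *)

Section SingleSiteGibbs.
Variables (V : choiceType) (d : nat) (E : set {fset V}).
Hypothesis cayleyE : cayley_tree d E.
Variables (R : realType) (beta la : R).
Implicit Types (i j k v : V) (s a : spin) (w z : V -> spin).

Definition conflict a s : R := (spin_val a * spin_val s == -1)%:R.

Definition site_weight j s w : R :=
  expR (- beta * \sum_(k <- nbr E j) conflict s (w k)) * la ^+ (s != Zero).

(** This turns the energy of the edges meeting [j] into a sum over its neighbours. *)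
Lemma edges_at j : set_bij [set` nbr E j]
  [set e | E e /\ (e `&` [fset j] != fset0)%fset] (fun k => [fset j; k]%fset).
Proof.
split.
- move=> k /=; rewrite (mem_nbr cayleyE) => /set_mem jk; split=> //.
  by apply/fset0Pn; exists j; rewrite !inE eqxx.
- move=> k k' /set_mem /=; rewrite (mem_nbr cayleyE) => jk _ /fsetP/(_ k).
  rewrite !inE eqxx orbT eq_sym => /esym /orP[/eqP kj|/eqP//].
  by have := adj_neq cayleyE jk; rewrite kj eqxx.
- move=> e /= [Ee /fset0Pn[j']]; rewrite !inE => /andP[+ /eqP j'j].
  rewrite {j'}j'j => je; case: cayleyE => _ [/(_ _ Ee) + _ _] _.
  rewrite (cardfsD1 j) je => -[/eqP/cardfs1P[k ek]].
  have ejk : e = [fset j; k]%fset by rewrite -[LHS](fsetD1K je) ek.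
  by exists k => //=; rewrite (mem_nbr cayleyE) /adj -ejk; exact/mem_set.
Qed.

Lemma weight1 j w : weight E beta la [fset j]%fset w = site_weight j (w j) w.
Proof.
rewrite /weight /site_weight big_seq_fset1; congr (expR (_ * _) * _).
rewrite /n_conflicts (reindex_fsbig _ _ _ _ (edges_at j)) -fsbig_seq ?uniq_nbr //.
rewrite big_seq [RHS]big_seq; apply: eq_bigr => k.
rewrite (mem_nbr cayleyE) => /(adj_neq cayleyE) jk.
by rewrite big_fsetU1 ?inE //= big_seq_fset1.
Qed.

Lemma glue1 j (w : {ffun [fset j]%fset -> spin}) z :
  Defs.glue w z = upd z j (w [` fset11 j]%fset).
Proof.
apply/funext => i; rewrite /Defs.glue /upd; case: insubP => [k|].
  rewrite inE => /eqP-> kj; rewrite eqxx; congr (w _); exact/val_inj.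
by rewrite inE => /negPf->.
Qed.

Variable mu : probability (Omega V) R.
Hypothesis gibbs_mu : gibbs E beta la mu.

Lemma site_weight_eq j s w z : {in nbr E j, w =1 z} ->
  site_weight j s w = site_weight j s z.
Proof.
move=> wz; rewrite /site_weight big_seq [in RHS]big_seq.
by under eq_bigr => k /wz -> do [].
Qed.

(** As [B] ignores the spin at [j] and pins those of its neighbours, the law of the resampled spin
    is the same throughout [B]. Cross-multiplication cancels the partition function. *)
Lemma single_site j (B : set (Omega V)) z0 : measurable B ->
    (forall w s, B w -> B (upd w j s)) ->
    (forall w, B w -> {in nbr E j, w =1 z0}) ->
  forall s s', pr mu (B `&` at_ j s) * site_weight j s' z0 =
               pr mu (B `&` at_ j s') * site_weight j s z0.
Proof.
move=> mB Bj Bz0.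
pose Z := partition_fun E beta la [fset j]%fset z0.
have wz (w : {ffun [fset j]%fset -> spin}) z : B z ->
   weight E beta la [fset j]%fset (Defs.glue w z) =
   site_weight j (w [` fset11 j]%fset) z0.
  move=> Bz; rewrite weight1 glue1 {1}/upd eqxx; apply: site_weight_eq => k jk.
  have /Bz0 -> // := Bj _ (w [` fset11 j]%fset) Bz.
suff H s : pr mu (B `&` at_ j s) = site_weight j s z0 / Z * pr mu B.
  by move=> s s'; rewrite !H; ring.
have ms := @measurable_at V j s.
apply: EFin_inj; rewrite -prE; last exact: measurableI.
rewrite (gibbs_mu [fset j]%fset); last exact: measurableI.
rewrite EFinM -prE //.
have -> : mu B = (\int[mu]_z (\1_B z)%:E)%E by rewrite integral_indic ?setIT.
rewrite -integralZl //; last first.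
  exact: integrable_indic.
apply: eq_integral => z _; rewrite /gamma_kernel -EFinM; congr EFin.
have [Bz|nBz] := pselect (B z); last first.
  (* Resampling [j] cannot lead into [B] from outside, as restoring the old spin would stay in
     [B]. *)
  rewrite indicE memNset // mulr0 big1 // => w _.
  rewrite indicE memNset ?mulr0 // glue1 => -[Bu _]; apply: nBz.
  have := Bj _ (z j) Bu; congr B; apply/funext => i.
  by rewrite /upd; case: eqP => [->|].
rewrite indicE mem_set // mulr1 (bigD1 [ffun=> s]) //= big1 => [|w ws].
  rewrite addr0 indicE mem_set; last first.
    rewrite glue1 ffunE; split; first exact: Bj.
    by rewrite /at_ /= /upd eqxx.
  rewrite mulr1 /gamma wz // ffunE; congr (_ / _).
  rewrite /Z /partition_fun; apply: eq_bigr => w _.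
  rewrite wz // weight1 glue1 {1}/upd eqxx; apply/esym/site_weight_eq => k jk.
  rewrite /upd ifN // eq_sym; move: jk; rewrite (mem_nbr cayleyE).
  exact: (adj_neq cayleyE).
rewrite indicE memNset ?mulr0 // glue1 => -[_]; rewrite /at_ /= /upd eqxx => wj.
case/eqP: ws; apply/ffunP => k; rewrite ffunE -wj; congr (w _).
by apply/val_inj => /=; apply/eqP; have := valP k; rewrite inE.
Qed.

End SingleSiteGibbs.

(** * Transition probabilities *)

Section Transitions.
Variables (V : choiceType) (d : nat) (E : set {fset V}).
Hypothesis cayleyE : cayley_tree d E.
Variables (R : realType) (beta la : R).
Hypothesis la_gt0 : 0 < la.
Variable mu : probability (Omega V) R.
Hypotheses (gibbs_mu : gibbs E beta la mu) (markov_mu : tree_markov_chain E mu).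
Hypothesis flip_mu : flip_invariant mu.
Implicit Types (i j k v : V) (s a : spin) (w z : V -> spin) (r : seq V).

Definition agr r z : set (Omega V) := [set w | forall v, v \in r -> w v = z v].

Lemma F_agr S r z : (forall v, v \in r -> S v) -> F S (agr r z).
Proof.
move=> Sr; apply: (determined_F Sr) => w w' ww' wz v vr.
by rewrite -ww' ?wz.
Qed.

Lemma measurable_agr r z : measurable (agr r z).
Proof. by apply: (@F_measurable _ setT); exact: F_agr. Qed.

Lemma site_weight_gt0 j s w : 0 < site_weight E beta la j s w.
Proof. by rewrite mulr_gt0 ?expR_gt0 ?exprn_gt0. Qed.

(** A starting point for changing spins one by one: the pattern is built site by site, some value of
    the next spin always having positive probability. *)
Lemma exists_charged r : exists z, 0 < pr mu (agr r z).
Proof.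
elim: r => [|v r [z zpos]].
  exists (fun _ => Zero); rewrite (_ : agr _ _ = setT) ?pr_setT //.
  by apply/seteqP; split.
move: zpos; rewrite (pr_split mu v (measurable_agr r z)).
have [[s spos] _|nos] := pselect (exists s, 0 < pr mu (agr r z `&` at_ v s)).
  exists (fun u => if u \in r then z u else s); apply: lt_le_trans spos _.
  apply: le_pr; do ?[exact: measurableI|exact: measurable_agr].
    by apply: measurableI; [exact: measurable_agr|exact: measurable_at].
  move=> w [wz ws] u; rewrite inE; case: ifP => [/wz//|ur].
  by rewrite orbF => /eqP->.
rewrite ltNge; case/negP; apply: sumr_le0 => s _; rewrite leNgt.
by apply/negP => spos; apply: nos; exists s.
Qed.

(** Finite energy: with all neighbours of [j] in the window, [single_site] compares the two patterns
    through positive weights. *)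
Lemma charged_upd r j z s : j \in r -> {subset nbr E j <= r} ->
  0 < pr mu (agr r z) -> 0 < pr mu (agr r (upd z j s)).
Proof.
move=> jr Nr; pose B := agr [seq v <- r | v != j] z.
have agrE x : agr r (upd z j x) = B `&` at_ j x.
  apply/seteqP; split=> w.
    move=> wu; split=> [v|]; last by rewrite /at_ /= wu // /upd eqxx.
    by rewrite mem_filter => /andP[/negPf vj vr]; rewrite wu // /upd vj.
  move=> [wB wj] v vr; rewrite /upd; case: eqP => [->//|/eqP vj].
  by apply: wB; rewrite mem_filter vj.
have -> : agr r z = B `&` at_ j (z j).
  by rewrite -agrE; congr agr; apply/funext => v; rewrite /upd; case: eqP => [->|].
rewrite agrE => pos.
have mB : measurable B by exact: measurable_agr.
have := single_site cayleyE gibbs_mu (j := j) (z0 := z) mB.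
move=> /(_ _ _ s (z j)) H.
rewrite -(pmulr_lgt0 _ (site_weight_gt0 j (z j) z)) H.
- by rewrite mulr_gt0 // site_weight_gt0.
- move=> w x wB v vr; rewrite /upd ifN ?wB //.
  by move: vr; rewrite mem_filter => /andP[].
move=> w wB k jk; apply: wB; rewrite mem_filter Nr // andbT eq_sym.
by apply: (adj_neq cayleyE); rewrite -(mem_nbr cayleyE).
Qed.

Lemma pr_pair_gt0 i j a s : adj E i j -> 0 < pr mu (at_ i a `&` at_ j s).
Proof.
move=> ij; have ji : adj E j i by rewrite adjC.
have [z zpos] := exists_charged (nbr E i ++ nbr E j).
set r := nbr E i ++ nbr E j in zpos *.
have ir : i \in r by rewrite mem_cat !(mem_nbr cayleyE) ji orbT.
have jr : j \in r by rewrite mem_cat !(mem_nbr cayleyE) ij.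
have Ni : {subset nbr E i <= r} by move=> v vi; rewrite mem_cat vi.
have Nj : {subset nbr E j <= r} by move=> v vj; rewrite mem_cat vj orbT.
have := charged_upd s jr Nj (charged_upd a ir Ni zpos).
move=> pos; apply: lt_le_trans pos _; apply: le_pr.
- exact: measurable_agr.
- by apply: measurableI; exact: measurable_at.
move=> w wz; split; rewrite /at_ /= wz.
- by rewrite /upd eqxx ifN // (adj_neq cayleyE).
- by [].
- by rewrite /upd eqxx.
- by [].
Qed.

Lemma exists_nbr j : exists i, adj E j i.
Proof.
have := size_nbr cayleyE j; case Nj: (nbr E j) => [//|i r] _; exists i.
by rewrite -(mem_nbr cayleyE) Nj mem_head.
Qed.

Lemma pr_at_gt0 i a : 0 < pr mu (at_ i a).
Proof.
have [j ij] := exists_nbr i.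
apply: lt_le_trans (pr_pair_gt0 a Zero ij) _; apply: le_pr.
- by apply: measurableI; exact: measurable_at.
- exact: measurable_at.
exact: subIsetl.
Qed.

Notation trans := (trans mu).

Lemma trans_gt0 i j a s : adj E i j -> 0 < trans i j a s.
Proof. by move=> ij; rewrite divr_gt0 ?pr_pair_gt0 ?pr_at_gt0. Qed.

Lemma trans_sum i j a : \sum_(s : spin) trans i j a s = 1.
Proof.
rewrite -mulr_suml -pr_split ?divff // ?gt_eqF ?pr_at_gt0 //.
exact: measurable_at.
Qed.

Lemma spin_oppK : involutive spin_opp. Proof. by case. Qed.

Lemma pr_flip (A : set (Omega V)) : measurable A ->
  pr mu [set w : Omega V | A (spin_opp \o w)] = pr mu A.
Proof. by move=> mA; rewrite /pr flip_mu. Qed.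

Lemma pr_at_flip i a : pr mu (at_ i (spin_opp a)) = pr mu (at_ i a).
Proof.
rewrite -(pr_flip (measurable_at i a)); congr (pr mu _).
by apply/seteqP; split=> w; rewrite /at_ /=; [move=> ->|move=> <-];
  rewrite spin_oppK.
Qed.

Lemma trans_flip i j a s : trans i j (spin_opp a) (spin_opp s) = trans i j a s.
Proof.
rewrite /trans pr_at_flip; congr (_ / _).
rewrite -(pr_flip (A := at_ i a `&` at_ j s)); last first.
  by apply: measurableI; exact: measurable_at.
congr (pr mu _); apply/seteqP; split=> w; rewrite /at_ /=.
  by move=> [-> ->]; rewrite !spin_oppK.
by move=> [<- <-]; rewrite !spin_oppK.
Qed.

Lemma markov_trans i j a s (B : set (Omega V)) : adj E i j ->
    F (past E i j) B -> B `<=` at_ i a ->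
  pr mu (B `&` at_ j s) = trans i j a s * pr mu B.
Proof.
by move=> ij FB Ba; apply: (markov_step markov_mu) => //;
  [exact: pr_at_gt0|exact: (past_self cayleyE)].
Qed.

(** Vacate the neighbours one after another; those already treated lie in the past of the edge to
    the next one. *)
Lemma markov_zeros j s r (B : set (Omega V)) : uniq r ->
    (forall k, k \in r -> adj E j k) -> (forall k, k \in r -> F (past E j k) B) ->
    B `<=` at_ j s ->
  pr mu (B `&` agr r (fun=> Zero)) = (\prod_(k <- r) trans j k s Zero) * pr mu B.
Proof.
elim: r => [|k r IHr] ur jr FB Bs.
  by rewrite big_nil mul1r (_ : agr _ _ = setT) ?setIT //; apply/seteqP; split.
have -> : B `&` agr (k :: r) (fun=> Zero) = (B `&` agr r (fun=> Zero)) `&` at_ k Zero.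
  apply/seteqP; split=> w.
    move=> [Bw w0]; do 2?split=> //; last by apply: w0; rewrite mem_head.
    by move=> v vr; apply: w0; rewrite inE vr orbT.
  by move=> [[Bw w0] wk]; split=> // v; rewrite inE => /predU1P[->|/w0].
case/andP: ur => kr ur.
rewrite (@markov_trans j k s) ?jr ?mem_head //.
- rewrite IHr // ?big_cons ?mulrA // => v vr; first by apply: jr; rewrite inE vr orbT.
  by apply: FB; rewrite inE vr orbT.
- apply: F_setI; first by apply: FB; rewrite mem_head.
  apply: F_agr => v vr; apply: (@desc_sibling _ _ _ cayleyE 0 j k v) => //.
  + by apply: jr; rewrite mem_head.
  + by apply: jr; rewrite inE vr orbT.
  + by apply: contraNneq kr => <-.
  + by rewrite mem_seq1.
by move=> w [/Bs].
Qed.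

Definition empty_below i j s := \prod_(k <- children E i j) trans j k s Zero.

Lemma empty_below_gt0 i j s : 0 < empty_below i j s.
Proof.
rewrite /empty_below big_seq; apply: prodr_gt0 => k.
by rewrite (mem_children cayleyE) => /andP[jk _]; exact: trans_gt0.
Qed.

(* The boundary law of the edge [ij], the paper's [xi] in the homogeneous case. *)
Definition activity i j := la * empty_below i j Zero / empty_below i j Plus.

Lemma activity_gt0 i j : 0 < activity i j.
Proof. by rewrite divr_gt0 ?mulr_gt0 ?empty_below_gt0. Qed.

(* The Gibbs ratio of the spins [s] and [0] at [j], with [a] at [i] and all
   children of [j] vacant; by the flip symmetry the factor [activity i j] does
   not depend on [s]. *)
Lemma trans_occupied i j a s : adj E i j -> s != Zero ->
  trans i j a s =
  activity i j * expR (- beta * conflict R s a) * trans i j a Zero.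
Proof.
move=> ij s0.
pose B := at_ i a `&` agr (children E i j) (fun=> Zero).
pose z0 v := if v == i then a else Zero.
have ij' := adj_neq cayleyE ij.
have mB : measurable B.
  by apply: measurableI; [exact: measurable_at|exact: measurable_agr].
have prB x : pr mu (B `&` at_ j x) =
    empty_below i j x * (trans i j a x * pr mu (at_ i a)).
  rewrite -[trans i j a x * _](@markov_trans i j a x) //; last first.
    by apply: F_at; exact: (past_self cayleyE).
  rewrite /B setIAC; apply: markov_zeros => //.
  - exact: uniq_children.
  - by move=> k; rewrite (mem_children cayleyE) => /andP[].
  - move=> k; rewrite (mem_children cayleyE) => /andP[jk ki].
    apply: F_setI; apply: F_at; last exact: (past_self cayleyE).
    by apply: (past_step cayleyE ij) => //; exact: (past_self cayleyE).
have weightE x : site_weight E beta la j x z0 =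
    expR (- beta * conflict R x a) * la ^+ (x != Zero).
  (* All edges at [j] other than [ij] lead to vacant sites, which conflict with nothing. *)
  rewrite /site_weight; congr (expR (_ * _) * _).
  transitivity (\sum_(k <- i :: children E i j) conflict R x (z0 k)).
    exact: perm_big (perm_nbr cayleyE ij).
  rewrite big_cons big_seq big1 => [|k]; first by rewrite addr0 /z0 eqxx.
  rewrite (mem_children cayleyE) /z0 => /andP[_ /negPf ->].
  by rewrite /conflict mulr0.
have := @single_site _ _ _ cayleyE _ _ _ _ gibbs_mu j B z0 mB.
move=> /(_ _ _ s Zero); rewrite !prB !weightE s0 /= expr0 mulr1.
have -> : conflict R Zero a = 0 by rewrite /conflict mul0r.
rewrite mulr0 expR0 mulr1 expr1 => H.
have Ps := empty_below_gt0 i j s.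
have Pi := pr_at_gt0 i a.
have Xs : empty_below i j s = empty_below i j Plus.
  case: s s0 {H prB Ps} => // _; apply: eq_bigr => k _.
  by rewrite -trans_flip.
apply: (@mulfI _ (empty_below i j s * pr mu (at_ i a))).
  by rewrite mulf_neq0 ?gt_eqF.
rewrite /activity -Xs.
transitivity (empty_below i j s * (trans i j a s * pr mu (at_ i a))); first by ring.
rewrite H.
- by field; rewrite gt_eqF.
- move=> w x [wi w0]; split; first by rewrite /at_ /= /upd ifN.
  move=> k ck; rewrite /upd ifN ?w0 //; move: ck.
  rewrite (mem_children cayleyE) => /andP[/(adj_neq cayleyE)].
  by rewrite eq_sym.
move=> w [wi w0] k; rewrite (perm_mem (perm_nbr cayleyE ij)) inE /z0.
by case: eqP => [->//|_] /= /w0.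
Qed.

(** The Ising bond between occupied neighbours, the form in which the repulsion enters the
    contraction argument. *)
Lemma trans_cross i j a : adj E i j -> a != Zero ->
  trans i j a (spin_opp a) = expR (- beta) * trans i j a a.
Proof.
move=> ij a0; have oa0 : spin_opp a != Zero by case: a a0.
rewrite (trans_occupied a ij a0) (trans_occupied a ij oa0).
have -> : conflict R (spin_opp a) a = 1 by case: a a0 {oa0}.
have -> : conflict R a a = 0 by case: a a0 {oa0}.
by rewrite mulr0 expR0 !mulr1; ring.
Qed.

Lemma trans_zeroE i j a : adj E i j ->
  trans i j a Zero * (1 + activity i j *
   (expR (- beta * conflict R Plus a) + expR (- beta * conflict R Minus a))) = 1.
Proof.
move=> ij; rewrite -[RHS](trans_sum i j a) big_spin /=.
rewrite (@trans_occupied i j a Plus) // (@trans_occupied i j a Minus) //.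
by ring.
Qed.

Lemma conflict_sum_ge1 a :
  1 <= expR (- beta * conflict R Plus a) + expR (- beta * conflict R Minus a).
Proof.
case: a.
- have -> : conflict R Minus Minus = 0 by [].
  by rewrite mulr0 expR0 lerDr expR_ge0.
- have -> : conflict R Minus Zero = 0 by [].
  by rewrite mulr0 expR0 lerDr ?expR_ge0 ?ler01.
- have -> : conflict R Plus Plus = 0 by [].
  by rewrite mulr0 expR0 lerDl expR_ge0.
Qed.

(** With [x] the activity, [trans_zeroE] bounds the left side by 1 / (1 + x) and makes
    [trans i j Zero Zero] equal to 1 / (1 + 2 x). *)
Lemma trans_zero_le2 i j a : adj E i j ->
  trans i j a Zero <= 2 * trans i j Zero Zero.
Proof.
move=> ij; have x_gt0 := activity_gt0 i j.
have := trans_zeroE a ij; have := trans_zeroE Zero ij.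
have -> : conflict R Plus Zero = 0 by [].
have -> : conflict R Minus Zero = 0 by [].
rewrite mulr0 expR0.
set x := activity i j in x_gt0 *.
have := trans_gt0 a Zero ij; have := trans_gt0 Zero Zero ij.
set t := trans i j a Zero; set t0 := trans i j Zero Zero => t0_gt0 t_gt0 H0.
set y := expR _ + expR _ => H.
have y1 : 1 <= y by exact: conflict_sum_ge1.
rewrite -(ler_pM2r (addr_gt0 ltr01 x_gt0)).
have tx : t * (1 + x) <= 1 by rewrite -[leRHS]H ler_pM2l // lerD2l ler_peMr // ltW.
nra.
Qed.

(** Each of the [d] children loses at most the factor 2 of [trans_zero_le2]. *)
Lemma activity_ge i j : adj E i j -> la / 2 ^+ d <= activity i j.
Proof.
move=> ij; rewrite /activity -mulrA ler_pM2l // ler_pdivlMr ?empty_below_gt0 //.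
rewrite mulrC ler_pdivrMr ?exprn_gt0 // -(size_children cayleyE ij) mulrC.
have -> : 2 ^+ size (children E i j) = \prod_(k <- children E i j) (2 : R).
  by rewrite big_const_seq count_predT iter_mulr_1.
rewrite /empty_below -big_split /= big_seq [leRHS]big_seq.
apply: ler_prod => k; rewrite (mem_children cayleyE) => /andP[jk _].
by rewrite ltW ?trans_gt0 //= trans_zero_le2.
Qed.

Lemma trans_zero_small i j a : adj E i j -> trans i j a Zero <= 2 ^+ d / la.
Proof.
move=> ij; have x_gt0 := activity_gt0 i j.
have -> : 2 ^+ d / la = (la / 2 ^+ d)^-1 by rewrite invf_div.
apply: (@le_trans _ _ (activity i j)^-1); last first.
  by rewrite lef_pV2 ?posrE ?activity_ge // divr_gt0 // exprn_gt0.
rewrite -[leRHS]mul1r ler_pdivlMr // -(trans_zeroE a ij).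
rewrite ler_pM2l ?trans_gt0 //.
set x := activity i j in x_gt0 *; set y := expR _ + expR _.
have y1 : 1 <= y by exact: conflict_sum_ge1.
nra.
Qed.

End Transitions.

(** * Percolation of good subtrees *)

Section Percolation.
Variables (V : choiceType) (d : nat) (E : set {fset V}).
Hypothesis cayleyE : cayley_tree d E.
Implicit Types (i j k v : V) (r : seq V).

Lemma F_exists S r (P : V -> set (V -> spin)) : (forall k, k \in r -> F S (P k)) ->
  F S [set w | exists2 k, k \in r & P k w].
Proof.
move=> FP; rewrite (_ : [set w | _] = \bigcup_(k in [set` r]) P k) //.
exact: (@fin_bigcup_measurable _ (Omega_on S)).
Qed.

(* At depth [n] below the edge [ij] there is no occupied subtree rooted at [j]
   in which every inner vertex keeps all but at most one of its children. *)
Fixpoint fail n i j : set (Omega V) :=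
  if n is n'.+1 then at_ j Zero `|` [set w | exists2 k, k \in children E i j &
    (fail n' j k `&` [set w | exists2 k',
       k' \in [seq k' <- children E i j | k' != k] & fail n' j k' w]) w]
  else at_ j Zero.

Lemma F_fail n i j : adj E i j -> F (past E j i) (fail n i j).
Proof.
elim: n i j => [|n IHn] i j ij.
  by apply: F_at; apply: (past_self cayleyE); rewrite adjC.
have Fk k : k \in children E i j -> F (past E j i) (fail n j k).
  rewrite (mem_children cayleyE) => /andP[jk ki].
  apply: F_sub (IHn _ _ jk); apply: (past_step cayleyE); rewrite 1?adjC //.
  by rewrite eq_sym.
apply: F_setU; first by apply: F_at; apply: (past_self cayleyE); rewrite adjC.
apply: F_exists => k ck; apply: F_setI; first exact: Fk.
by apply: F_exists => k'; rewrite mem_filter => /andP[_ /Fk].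
Qed.

Lemma fail_le n m i j : (n <= m)%N -> fail n i j `<=` fail m i j.
Proof.
elim: n m i j => [|n IHn] [|m] i j // nm w.
- by [].
- by left.
move=> [wj|[k ck [fk [k' ck' fk']]]]; [by left|right].
exists k => //; split; first exact: IHn fk.
by exists k' => //; exact: IHn fk'.
Qed.

Definition fail_ever i j := \bigcup_n fail n i j.

Lemma F_fail_ever i j : adj E i j -> F (past E j i) (fail_ever i j).
Proof. by move=> ij; apply: F_bigcup => n; exact: F_fail. Qed.

(* [n + 1] disjoint branches all fail. *)
Fixpoint fail_around n i j : set (Omega V) :=
  if n is n'.+1 then
    if children E i j is k :: k' :: _ then
      fail_ever j k `&` fail_around n' j k'
    else set0
  else fail_ever i j.

Lemma F_fail_around n i j : adj E i j -> F (past E j i) (fail_around n i j).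
Proof.
elim: n i j => [|n IHn] i j ij; first exact: F_fail_ever.
rewrite /=; case chE: children => [|k [|k' r]]; try exact: F_set0.
have up l : l \in children E i j -> adj E j l /\ past E l j `<=` past E j i.
  rewrite (mem_children cayleyE) => /andP[jl li]; split=> //.
  by apply: (past_step cayleyE); rewrite 1?adjC // eq_sym.
have [jk sk] := up k (ltac:(by rewrite chE mem_head)).
have [jk' sk'] := up k' (ltac:(by rewrite chE !inE eqxx orbT)).
by apply: F_setI; [exact: F_sub sk _ (F_fail_ever jk)|exact: F_sub sk' _ (IHn _ _ jk')].
Qed.

Variables (R : realType) (mu : probability (Omega V) R) (eps : R).
Hypothesis zero_le : forall i j (B : set (Omega V)), adj E i j ->
  F (past E i j) B -> pr mu (B `&` at_ j Zero) <= eps * pr mu B.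
Hypotheses (eps_ge0 : 0 <= eps) (eps_small : 4 * d%:R ^+ 2 * eps <= 1).

(** A bound on the conditional probability of [Y] given the past of the edge, in integrated form to
    avoid choosing versions. *)
Definition rare i j a (Y : set (Omega V)) := forall B : set (Omega V),
  F (past E i j) B -> pr mu (B `&` Y) <= a * pr mu B.

Lemma pr_exists_le r (P : V -> set (Omega V)) (B : set (Omega V)) c :
  measurable B ->
  (forall k, k \in r -> measurable (P k) /\ pr mu (B `&` P k) <= c) ->
  pr mu (B `&` [set w | exists2 k, k \in r & P k w]) <= (size r)%:R * c.
Proof.
move=> mB; elim: r => [|k r IHr] H.
  rewrite (_ : _ `&` _ = set0) ?mul0r; last first.
    by rewrite -subset0 => w [_ [k]].
  by rewrite /pr measure0.
have Hr l : l \in r -> measurable (P l) /\ pr mu (B `&` P l) <= c.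
  by move=> lr; apply: H; rewrite inE lr orbT.
have [mk lek] := H k (mem_head _ _).
have mr : measurable [set w : Omega V | exists2 l, l \in r & P l w].
  by apply: (@F_exists setT) => l /Hr[].
have -> : B `&` [set w | exists2 l, l \in k :: r & P l w] =
    (B `&` P k) `|` (B `&` [set w | exists2 l, l \in r & P l w]).
  apply/seteqP; split=> w.
    move=> [Bw [l]]; rewrite inE => /predU1P[->|lr] Pl; [by left|right].
    by split=> //; exists l.
  move=> [[Bw Pk]|[Bw [l lr Pl]]]; split=> //.
    by exists k; rewrite ?mem_head.
  by exists l; rewrite // inE lr orbT.
apply: le_trans (prU_le _ _ _) _; do ?exact: measurableI.
by rewrite /= -natr1 mulrDl mul1r addrC lerD ?IHr.
Qed.

(** The event [Y] lives on the branch of [k], hence in the past of the edge to [k'], so it can be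
    added to the condition in the bound for [Y']. *)
Lemma rare_setI j k k' a b Y Y' : 0 <= b -> adj E j k -> adj E j k' -> k' != k ->
    F (past E k j) Y -> rare j k a Y -> rare j k' b Y' ->
  forall B, F (past E j k) B -> F (past E j k') B ->
    pr mu (B `&` (Y `&` Y')) <= b * a * pr mu B.
Proof.
move=> b0 jk jk' k'k FY rY rY' B FB FB'; rewrite setIA.
apply: le_trans (rY' _ _) _; last by rewrite -mulrA ler_wpM2l // rY.
apply: F_setI => //; apply: F_sub FY.
by apply: (past_step cayleyE) => //; rewrite adjC.
Qed.

(** A vacancy costs [eps] and two failing children at most d^2 (2 eps)^2, which is at most [eps] by
    [eps_small]; together 2 [eps] again. *)
Lemma rare_fail n i j : adj E i j -> rare i j (2 * eps) (fail n i j).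
Proof.
elim: n i j => [|n IHn] i j ij B FB.
  apply: le_trans (zero_le ij FB) _; rewrite ler_wpM2r ?pr_ge0 //.
  by rewrite ler_peMl // ler1n.
have mB := F_measurable FB.
rewrite /=; set Z := (X in at_ j Zero `|` X).
have FBk k : k \in children E i j -> [/\ adj E j k & F (past E j k) B].
  rewrite (mem_children cayleyE) => /andP[jk ki]; split=> //.
  by apply: F_sub FB; exact: (past_step cayleyE ij jk ki).
have mfail k : k \in children E i j -> measurable (fail n j k).
  by move=> /FBk[jk _]; exact: F_measurable (F_fail n jk).
have Zle : pr mu (B `&` Z) <= d%:R * (d%:R * (2 * eps * (2 * eps) * pr mu B)).
  rewrite -{1}(size_children cayleyE ij); apply: pr_exists_le => // k ck.
  have mex : measurable [set w : Omega V | exists2 k',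
       k' \in [seq k' <- children E i j | k' != k] & fail n j k' w].
    apply: (@F_exists setT) => k'; rewrite mem_filter => /andP[_]; exact: mfail.
  split; first by apply: measurableI => //; exact: mfail.
  rewrite setIA; have mBk : measurable (B `&` fail n j k).
    by apply: measurableI => //; exact: mfail.
  apply: le_trans (@pr_exists_le _ _ _ (2 * eps * (2 * eps) * pr mu B) mBk _) _.
    move=> k'; rewrite mem_filter => /andP[k'k ck'].
    have [jk FBk1] := FBk k ck; have [jk' FBk'] := FBk k' ck'.
    split; first exact: mfail.
    rewrite -setIA; apply: (rare_setI _ jk jk') => //.
    + by rewrite mulr_ge0.
    + exact: F_fail.
    + exact: IHn.
    + exact: IHn.
  rewrite ler_wpM2r ?mulr_ge0 ?pr_ge0 // ler_nat size_filter.
  by rewrite -(size_children cayleyE ij) count_size.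
rewrite setIUr; apply: le_trans (prU_le _ _ _) _.
- by apply: measurableI => //; exact: measurable_at.
- apply: measurableI => //; apply: (@F_exists setT) => k ck.
  apply: F_setI; first exact: mfail.
  by apply: F_exists => k'; rewrite mem_filter => /andP[_]; exact: mfail.
have := zero_le ij FB; have := pr_ge0 mu B.
move: Zle; set p := pr mu B; set x := pr mu (B `&` Z).
move=> Zle p0 zle; apply: le_trans (lerD zle Zle) _.
have : 4 * d%:R ^+ 2 * eps * (eps * p) <= 1 * (eps * p).
  by apply: ler_wpM2r => //; exact: mulr_ge0.
nra.
Qed.

(** The bound is uniform in the depth, so it passes to the increasing union. *)
Lemma rare_fail_ever i j : adj E i j -> rare i j (2 * eps) (fail_ever i j).
Proof.
move=> ij B FB; have mB := F_measurable FB.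
have mf n : measurable (B `&` fail n i j).
  by apply: measurableI => //; exact: F_measurable (F_fail n ij).
have mU : measurable (B `&` fail_ever i j).
  by apply: measurableI => //; exact: F_measurable (F_fail_ever ij).
rewrite -lee_fin -prE // /fail_ever setI_bigcupr.
have := @nondecreasing_cvg_mu _ _ _ mu (fun n => B `&` fail n i j) mf.
rewrite -setI_bigcupr => /(_ mU).
move=> cvgU; have {}cvgU := cvgU (ltac:(
  by move=> n m nm; apply/subsetPset; apply: setIS; exact: fail_le)).
by apply: cvge_le cvgU; apply: nearW => n /=; rewrite prE // lee_fin rare_fail.
Qed.

(** The branches hang off a ray one after another, and [rare_setI] multiplies their bounds. *)
Lemma rare_fail_around n i j : adj E i j ->
  rare i j ((2 * eps) ^+ n.+1) (fail_around n i j).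
Proof.
elim: n i j => [|n IHn] i j ij B FB; first by rewrite expr1 rare_fail_ever.
rewrite /=; case chE: children => [|k [|k' r]].
- by rewrite setI0 /pr measure0 /= mulr_ge0 ?exprn_ge0 ?mulr_ge0 ?pr_ge0.
- by rewrite setI0 /pr measure0 /= mulr_ge0 ?exprn_ge0 ?mulr_ge0 ?pr_ge0.
have up l : l \in children E i j -> adj E j l /\ F (past E j l) B.
  rewrite (mem_children cayleyE) => /andP[jl li]; split=> //.
  by apply: F_sub FB; exact: (past_step cayleyE ij jl li).
have [jk FBk] := up k (ltac:(by rewrite chE mem_head)).
have [jk' FBk'] := up k' (ltac:(by rewrite chE !inE eqxx orbT)).
rewrite exprSr; apply: (rare_setI _ jk jk') => //.
- by rewrite exprn_ge0 // mulr_ge0.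
- have := uniq_children E i j; rewrite chE /= inE negb_or => /andP[/andP[kk' _] _].
  by rewrite eq_sym.
- exact: F_fail_ever.
- exact: rare_fail_ever.
- exact: IHn.
Qed.

Lemma pr_fail_around n i j : adj E i j -> (1 < d)%N ->
  pr mu (fail_around n i j) <= 2^-1 ^+ n.
Proof.
move=> ij d1; have := @rare_fail_around n i j ij setT (@F_setT _ (past E i j)).
rewrite setTI pr_setT mulr1 => /le_trans; apply.
have d2 : (2 : R) <= d%:R by rewrite ler_nat.
have e4 : 2 * eps <= 2^-1.
  have : 4 * 2 ^+ 2 * eps <= 4 * d%:R ^+ 2 * eps.
    by rewrite ler_wpM2r // ler_wpM2l // lerXn2r ?nnegrE.
  by move=> /le_trans/(_ eps_small); lra.
apply: (@le_trans _ _ ((2 * eps) ^+ n)).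
  by rewrite exprSr ler_piMr ?exprn_ge0 ?mulr_ge0 //; lra.
by rewrite lerXn2r ?nnegrE ?mulr_ge0.
Qed.

(** Without any good vertex the configuration lies in all the events [fail_around n i j], whose
    probabilities decay exponentially in [n]. *)
Lemma fail_aroundP w : (1 < d)%N -> (forall i j, adj E i j -> fail_ever i j w) ->
  forall n i j, adj E i j -> fail_around n i j w.
Proof.
move=> d1 H; elim=> [|n IHn] i j ij; first exact: H.
have := size_children cayleyE ij; rewrite /=.
case chE: children => [|k [|k' r]] /= sz; try by move: d1; rewrite -sz.
have up l : l \in children E i j -> adj E j l.
  by rewrite (mem_children cayleyE) => /andP[].
by split; [apply: H|apply: IHn]; apply: up; rewrite chE !inE eqxx ?orbT.
Qed.

End Percolation.

(** * Time evolution *)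

Section SitePropagation.
Variables (R : realType) (t : R).
Hypothesis t_ge0 : 0 <= t.
Implicit Types (a s : spin).

Lemma decay_le1 : expR (- (2 * t)) <= 1.
Proof. by rewrite -expR0 ler_expR oppr_le0 mulr_ge0. Qed.

Lemma p_site_ge0 a s : 0 <= p_site t a s.
Proof.
have := decay_le1; have := expR_ge0 (- (2 * t)).
rewrite /p_site; case: a; case: s => /=; rewrite ?mulr0 ?mulr1 ?addr0 ?add0r //;
  by move=> *; lra.
Qed.

Lemma p_site_zero a : p_site t a Zero = (a == Zero)%:R.
Proof. by rewrite /p_site; case: a => /=; rewrite ?mulr0 ?addr0 ?add0r. Qed.

Lemma p_zero_site s : p_site t Zero s = (s == Zero)%:R.
Proof. by rewrite /p_site; case: s => /=; rewrite ?mulr0 ?addr0 ?add0r. Qed.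

Lemma p_site_same a : a != Zero ->
  p_site t a a = 2^-1 * (1 + expR (- (2 * t))).
Proof.
by rewrite /p_site; case: a => //= _; rewrite ?mulr1 ?mulr0 ?addr0.
Qed.

Lemma p_site_opp a : a != Zero ->
  p_site t a (spin_opp a) = 2^-1 * (1 - expR (- (2 * t))).
Proof.
by rewrite /p_site; case: a => //= _; rewrite ?mulr1 ?mulr0 ?addr0 ?add0r.
Qed.

End SitePropagation.

Section LocalFunctions.
Variables (V : choiceType).

Lemma measurable_local d' (T : measurableType d') (r : seq V) (f : Omega V -> T) :
  (forall w w' : Omega V, (forall v, v \in r -> w v = w' v) -> f w = f w') ->
  measurable_fun setT f.
Proof.
move=> Df _ A _; rewrite setTI; apply: (@F_measurable _ setT).
by apply: (@determined_F _ _ r) => // w w' ww' /=; rewrite (Df w w').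
Qed.

End LocalFunctions.

Section TimeEvolved.
Variables (V : choiceType) (R : realType) (t : R).
Hypothesis t_ge0 : 0 <= t.
Variables mu mut : probability (Omega V) R.
Hypothesis evolved : time_evolved t mu mut.
Implicit Types (v : V) (z : V -> spin) (r : seq V).

Definition occupation_set (X : set (Omega V)) := forall w w' : Omega V,
  (forall v, (w v == Zero) = (w' v == Zero)) -> X w -> X w'.

(* The kernel almost surely preserves every vacancy, and there are countably
   many sites. *)
Lemma mut_occupation X : countable [set: V] -> measurable X ->
  occupation_set X -> mut X = mu X.
Proof.
move=> /countable_injP[f finj] mX occX; have [K Kprod mutE] := evolved.
have Kat w v s : K w (at_ v s) = (p_site t (w v) s)%:E.
  have := Kprod w [fset v]%fset (fun=> s).
  rewrite big_seq_fset1 => <-; congr (K w _); apply/seteqP; split=> w'.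
    by move=> wv u; rewrite inE => /eqP->.
  by apply; rewrite inE.
pose N w v : set (Omega V) := [set w' | (w v == Zero) != (w' v == Zero)].
(* [p_site] vanishes when exactly one of its two spins is zero. *)
have N0 w v : (K w).-negligible (N w v).
  have atN s : s != w v -> (s == Zero) || (w v == Zero) -> (K w).-negligible (at_ v s).
    move=> sw sz; exists (at_ v s); split => //; first exact: measurable_at.
    rewrite Kat; case/orP: sz sw => /eqP->; last by rewrite p_zero_site => /negPf->.
    by rewrite p_site_zero eq_sym => /negPf->.
  case: (eqVneq (w v) Zero) => wv.
    apply: (@negligibleS _ _ _ _ (at_ v Plus `|` at_ v Minus)); last first.
      by apply: negligibleU; apply: atN; rewrite wv.
    by move=> w'; rewrite /N /at_ /= wv; case: (w' v) => // _; [right|left].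
  apply: (@negligibleS _ _ _ _ (at_ v Zero)); last by apply: atN; rewrite // eq_sym.
  by move=> w'; rewrite /N /at_ /= (negPf wv); case: (w' v).
have NK w : (K w).-negligible [set w' | exists v, N w v w'].
  have -> : [set w' | exists v, N w v w'] =
     \bigcup_n [set w' | exists2 v, f v = n & N w v w'].
    apply/seteqP; split=> w'; first by move=> [v ?]; exists (f v) => //; exists v.
    by move=> [n _ [v _ ?]]; exists v.
  apply: negligible_bigcup => n.
  have [[v fv]|nv] := pselect (exists v, f v = n).
    apply: negligibleS (N0 w v) => w' [v' fv' ?].
    by rewrite (_ : v = v') //; apply: finj; rewrite ?inE // fv fv'.
  rewrite (_ : [set w' | _] = set0); first exact: negligible_set0.
  by rewrite -subset0 => w' [v fv _]; apply: nv; exists v.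
have KX w : K w X = (\1_X w)%:E.
  have [M [mM M0 NM]] := NK w.
  have same w' : ~ M w' -> forall v, (w v == Zero) = (w' v == Zero).
    move=> nM v; apply: contra_notP nM => /eqP nwv; apply: NM.
    by exists v.
  have Ksub A : measurable A -> A `<=` M -> K w A = 0%E.
    by move=> mA AM; apply: subset_measure0 AM _.
  rewrite indicE; case: (pselect (X w)) => Xw.
    have : K w (~` X `|` X) = 1%E by rewrite setvU prob_kernel.
    rewrite mem_set // measureU ?setICl //; last exact: measurableC.
    move=> KU; rewrite [RHS](esym KU) -[LHS]add0e; congr (_ + _)%E; apply/esym/Ksub.
      exact: measurableC.
    move=> w' nX; apply: contrapT => /same ww'; apply: nX; exact: occX Xw.
  rewrite memNset //; apply: Ksub => // w' Xw'; apply: contrapT => /same ww'.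
  by apply: Xw; apply: occX Xw' => v; rewrite ww'.
rewrite mutE //; under eq_integral => w _ do rewrite KX.
by rewrite integral_indic ?setIT.
Qed.

(* The integral over [B] of [\prod_(v <- r) p_site t (w v) (z v)], see [wintE]. *)
Fixpoint wint z r (B : set (Omega V)) : R :=
  if r is v :: r' then \sum_(s : spin) p_site t s (z v) * wint z r' (B `&` at_ v s)
  else pr mu B.

Lemma integral_split v (B : set (Omega V)) (f : Omega V -> \bar R) : measurable B ->
    measurable_fun [set: Omega V] f -> (forall w, 0 <= f w)%E ->
  (\int[mu]_(w in B) f w = \sum_(s : spin) \int[mu]_(w in B `&` at_ v s) f w)%E.
Proof.
move=> mB mf f0; rewrite big_spin.
have mI s : measurable (B `&` at_ v s).
  by apply: measurableI => //; exact: measurable_at.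
rewrite [in LHS](_ : B = (B `&` at_ v Plus) `|`
    ((B `&` at_ v Minus) `|` (B `&` at_ v Zero))); last first.
  rewrite -!setIUr -[LHS]setIT; congr (_ `&` _).
  apply/seteqP; split=> // w _; rewrite /at_ /=.
  by case: (w v); [right; left|right; right|left].
rewrite ge0_integral_setU //=; first last.
- by apply/disj_setPS => w [[_ +] [[_]|[_]]]; rewrite /at_ /= => ->.
- exact: measurable_funTS.
- exact: measurableU.
rewrite ge0_integral_setU //=; first exact: measurable_funTS.
by apply/disj_setPS => w [[_ +] [_]]; rewrite /at_ /= => ->.
Qed.

Lemma wintE z r (B : set (Omega V)) : measurable B ->
  (\int[mu]_(w in B) (\prod_(v <- r) p_site t (w v) (z v))%:E =
   (wint z r B)%:E)%E.
Proof.
elim: r B => [|v r IHr] B mB /=.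
  under eq_integral => w _ do rewrite big_nil.
  by rewrite integral_cst // mul1e; exact: prE.
have mI s : measurable (B `&` at_ v s).
  by apply: measurableI => //; exact: measurable_at.
have prod_ge0 r' w : 0 <= \prod_(u <- r') p_site t (w u) (z u).
  by rewrite prodr_ge0 // => u _; exact: p_site_ge0.
have mprod r' : measurable_fun setT
    (fun w : Omega V => (\prod_(u <- r') p_site t (w u) (z u))%:E).
  apply: (@measurable_local _ _ _ r') => w w' ww'; congr EFin.
  by rewrite big_seq [in RHS]big_seq; apply: eq_bigr => u /ww'->.
rewrite (integral_split v) // => [|w]; last by rewrite lee_fin.
rewrite -sumEFin; apply: eq_bigr => s _; rewrite EFinM -IHr //.
rewrite -ge0_integralZl_EFin ?p_site_ge0 //; last 2 first.
- by move=> w _; rewrite lee_fin.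
- exact: measurable_funTS.
apply: eq_integral => w /set_mem[_]; rewrite /at_ /= => wv.
by rewrite big_cons wv EFinM.
Qed.

Lemma mut_agree (L : {fset V}) z r : uniq r -> L =i r ->
  mut (agree L z) = (wint z r setT)%:E.
Proof.
move=> ur Lr; have [K Kprod mutE] := evolved.
have -> : agree L z = agr r z.
  by apply/seteqP; split=> w wz v; rewrite ?Lr => vr; apply: wz; rewrite ?Lr.
rewrite mutE; last exact: measurable_agr.
rewrite -wintE //; apply: eq_integral => w _.
have -> : agr r z = agree L z.
  by apply/seteqP; split=> w' wz v; rewrite ?Lr => vr; apply: wz; rewrite ?Lr.
by rewrite Kprod; congr EFin; apply: perm_big; apply: uniq_perm.
Qed.

(** If integrating over [r2] gives a constant factor on all subevents of [A] in [F S], this factor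
    comes out of the sums over [r1], whose slices of [B] are such subevents. *)
Lemma wint_cat z r1 r2 S (A B : set (Omega V)) c :
    (forall C : set (Omega V), F S C -> C `<=` A -> wint z r2 C = c * pr mu C) ->
    (forall v, v \in r1 -> S v) -> F S B -> B `<=` A ->
  wint z (r1 ++ r2) B = c * wint z r1 B.
Proof.
move=> H; elim: r1 B => [|v r1 IHr] B Sr FB BA /=; first exact: H.
rewrite mulr_sumr; apply: eq_bigr => s _; rewrite IHr; first by rewrite mulrCA.
- by move=> u ur; apply: Sr; rewrite inE ur orbT.
- by apply: F_setI => //; apply: F_at; apply: Sr; exact: mem_head.
by move=> w [/BA].
Qed.

End TimeEvolved.

(** * Recursion for the likelihood of an evolved configuration *)

Section Messages.
Variables (V : choiceType) (d : nat) (E : set {fset V}).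
Hypothesis cayleyE : cayley_tree d E.
Variables (R : realType) (t : R) (mu : probability (Omega V) R).
Notation trans := (trans mu).
Hypothesis markov_trans : forall i j a s (B : set (Omega V)), adj E i j ->
  F (past E i j) B -> B `<=` at_ i a ->
  pr mu (B `&` at_ j s) = trans i j a s * pr mu B.
Implicit Types (i j k u v : V) (a c s : spin) (z : V -> spin).

(* The probability that the evolved configuration equals [z] on [desc n i j],
   given the initial spin [c] at [j]. *)
Fixpoint msg z n i j c : R :=
  p_site t c (z j) *
  (if n is n'.+1 then
     \prod_(k <- children E i j) \sum_(c' : spin) trans j k c c' * msg z n' j k c'
   else 1).

(** The probability of the same evolved pattern, given instead the initial spin [a] at the parent
    [i]. *)
Definition branch z n i j a := \sum_(c : spin) trans i j a c * msg z n i j c.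

Notation wint := (wint t mu).

(** [S] collects the sites on which the event may depend. It grows with each branch but stays in the
    past of the edges still to come, so the branches give independent factors. *)
Lemma wint_flatten z n j s ks S (B : set (Omega V)) : uniq ks ->
    (forall k, k \in ks -> [/\ adj E j k, S `<=` past E j k &
       forall C : set (Omega V), F (past E j k) C -> C `<=` at_ j s ->
         wint z (desc E n j k) C = branch z n j k s * pr mu C]) ->
    F S B -> B `<=` at_ j s ->
  wint z (flatten [seq desc E n j k | k <- ks]) B =
  (\prod_(k <- ks) branch z n j k s) * pr mu B.
Proof.
elim: ks S B => [|k ks IHks] S B; first by rewrite big_nil mul1r.
move=> /= /andP[kks uks] H FB Bs.
have [jk Sk Hk] := H k (mem_head _ _).
have Hks k' : k' \in ks -> [/\ adj E j k', S `<=` past E j k' &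
       forall C : set (Omega V), F (past E j k') C -> C `<=` at_ j s ->
         wint z (desc E n j k') C = branch z n j k' s * pr mu C].
  by move=> kk'; apply: H; rewrite inE kk' orbT.
rewrite (@wint_cat _ _ _ _ _ _ _ (S `|` [set` desc E n j k]) (at_ j s) _
  (\prod_(k' <- ks) branch z n j k' s)) //.
- rewrite Hk //; last exact: F_sub FB.
  by rewrite big_cons mulrCA mulrA.
- move=> C FC Cs; apply: (IHks (S `|` [set` desc E n j k])) => // k' ck'.
  have [jk' Sk' Hk'] := Hks _ ck'; split=> // v [/Sk'//|/= vk].
  apply: (desc_sibling cayleyE jk' jk _ vk).
  by apply: contraNneq kks => ->.
- by move=> v vk; right.
- by apply: F_sub FB; left.
Qed.

Lemma wint_desc z n i j a (B : set (Omega V)) : adj E i j ->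
    F (past E i j) B -> B `<=` at_ i a ->
  wint z (desc E n i j) B = branch z n i j a * pr mu B.
Proof.
elim: n i j a B => [|n IHn] i j a B ij FB Ba /=.
  rewrite /branch mulr_suml; apply: eq_bigr => c _ /=.
  by rewrite (@markov_trans i j a c) //; ring.
rewrite /branch mulr_suml; apply: eq_bigr => c _ /=.
rewrite (@wint_flatten z n j c (children E i j) (past E i j `|` [set j])).
- by rewrite (@markov_trans i j a c) //; rewrite /branch; ring.
- exact: uniq_children.
- move=> k; rewrite (mem_children cayleyE) => /andP[jk ki]; split=> //.
    move=> v [|->]; [exact: (past_step cayleyE ij jk ki)|exact: (past_self cayleyE)].
  by move=> C FC Cs; exact: IHn.
- apply: F_setI; first by apply: F_sub FB; left.
  by apply: F_at; right.
- exact: subIsetr.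
Qed.

Lemma wint_tree_ball z n u :
  wint z (tree_ball E n u) setT = \sum_(a : spin) p_site t a (z u) *
    (pr mu (at_ u a) * \prod_(k <- nbr E u) branch z n u k a).
Proof.
rewrite /tree_ball /=; apply: eq_bigr => a _; congr (_ * _); rewrite setTI mulrC.
apply: (@wint_flatten _ _ _ _ _ [set u]) => //.
- exact: uniq_nbr.
- move=> k; rewrite (mem_nbr cayleyE) => uk; split=> //.
    by move=> v ->; exact: (past_self cayleyE).
  by move=> C FC Cs; exact: wint_desc.
- exact: F_at.
Qed.

Lemma eq_msg z z' n i j c : {in desc E n i j, z =1 z'} ->
  msg z n i j c = msg z' n i j c.
Proof.
elim: n i j c => [|n IHn] i j c zz' /=; first by rewrite zz' ?mem_head.
rewrite zz' ?mem_head //; congr (_ * _).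
rewrite big_seq [RHS]big_seq; apply: eq_bigr => k ck.
apply: eq_bigr => c' _; rewrite (IHn j k) // => v vk; apply: zz'.
by rewrite in_cons; apply/orP; right; apply/flatten_mapP; exists k.
Qed.

Lemma eq_branch z z' n i j a : {in desc E n i j, z =1 z'} ->
  branch z n i j a = branch z' n i j a.
Proof. by move=> zz'; apply: eq_bigr => c _; rewrite (eq_msg _ zz'). Qed.

End Messages.

(** * Likelihood ratios *)

(** If no factor is exceptional, one [y >= 1] is replaced by [x <= 1]. *)
Lemma prod_one_exception (R : realFieldType) (I : eqType) (r : seq I) (b : I -> bool)
    (x y : R) : 0 <= x <= 1 -> 1 <= y -> uniq r -> (0 < size r)%N ->
    (forall k k', k \in r -> k' \in r -> b k -> b k' -> k' = k) ->
  x * y ^+ (size r).-1 <= \prod_(k <- r) (if b k then x else y).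
Proof.
move=> /andP[x0 x1] y1 ur r0 b1.
have y0 : 0 <= y by exact: le_trans y1.
have [/hasP[k kr bk]|/hasPn nb] := boolP (has b r).
  rewrite (big_rem k) //= bk ler_wpM2l //.
  rewrite -(size_rem kr) big_seq.
  rewrite (eq_bigr (fun=> y)) => [|k' k'r]; last first.
    move: k'r; rewrite mem_rem_uniq // inE => /andP[/eqP k'k k'r].
    by case: ifP => // /(b1 _ _ kr k'r bk).
  by rewrite -big_seq big_const_seq count_predT iter_mulr_1.
rewrite big_seq (eq_bigr (fun=> y)) => [|k /nb/negPf->//].
rewrite -big_seq big_const_seq count_predT iter_mulr_1.
apply: (@le_trans _ _ (1 * y ^+ (size r).-1)); first by rewrite ler_wpM2r ?exprn_ge0.
by rewrite mul1r ler_weXn2l // leq_pred.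
Qed.

Section Contraction.
Variables (V : choiceType) (d : nat) (E : set {fset V}).
Hypothesis cayleyE : cayley_tree d E.
Hypothesis d_ge4 : (4 <= d)%N.
Variables (R : realType) (t : R) (mu : probability (Omega V) R).
Variable X : R.
Hypotheses (t_ge1 : 1 <= t) (X_ge16 : 16 <= X).
Notation trans := (trans mu).
Notation msg := (msg E t mu).
Notation branch := (branch E t mu).
Hypothesis trans_gt0 : forall i j a s, adj E i j -> 0 < trans i j a s.
Hypothesis trans_flip : forall i j a s,
  trans i j (spin_opp a) (spin_opp s) = trans i j a s.
Hypothesis trans_cross : forall i j a, adj E i j -> a != Zero ->
  trans i j a (spin_opp a) = X^-1 * trans i j a a.
Implicit Types (i j k u v : V) (a c s tau : spin) (z : V -> spin).

Let t_ge0 : 0 <= t. Proof. exact: le_trans t_ge1. Qed.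
Let X_gt0 : 0 < X. Proof. by apply: lt_le_trans X_ge16; rewrite ltr0n. Qed.

Let X_ge1 : 1 <= X. Proof. by apply: le_trans X_ge16; rewrite ler1n. Qed.

Let decay := expR (- (2 * t)).
Let p_same := 2^-1 * (1 + decay).
Let p_diff := 2^-1 * (1 - decay).

Lemma decay_gt0 : 0 < decay. Proof. exact: expR_gt0. Qed.

(** From e^(2t) >= 1 + 2t >= 3. The field ratio is then at most (1 + 1/3) / (1 - 1/3) = 2, see
    [p_same_le]. *)
Lemma decay_le3 : decay <= 3^-1.
Proof.
rewrite /decay expRN lef_pV2 ?posrE ?expR_gt0 //.
apply: (@le_trans _ _ (1 + 2 * t)); last exact: expR_ge1Dx.
by have := t_ge1; lra.
Qed.

Lemma p_diff_gt0 : 0 < p_diff.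
Proof. by rewrite /p_diff; have := decay_le3; lra. Qed.

Lemma p_same_le : p_same <= 2 * p_diff.
Proof. by rewrite /p_same /p_diff; have := decay_le3; lra. Qed.

(** The likelihood ratio carried by one evolved spin, that is, the exponential of the field. *)
Definition theta := p_same / p_diff.

Lemma theta_gt1 : 1 < theta.
Proof.
rewrite /theta ltr_pdivlMr ?p_diff_gt0 // mul1r /p_same /p_diff.
by have := decay_gt0; lra.
Qed.

Lemma opp_neq0 tau : tau != Zero -> spin_opp tau != Zero.
Proof. by case: tau. Qed.

Lemma occupied_cases tau s : tau != Zero -> s != Zero -> s = tau \/ s = spin_opp tau.
Proof. by case: tau; case: s => //; [left|right|right|left]. Qed.

Lemma p_siteE a s : a != Zero -> s != Zero ->
  p_site t a s = if s == a then p_same else p_diff.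
Proof.
move=> a0 s0; case: (occupied_cases a0 s0) => ->.
  by rewrite eqxx p_site_same.
by rewrite p_site_opp //; case: a a0 {s0}.
Qed.

Lemma spin_opp_neq tau : tau != Zero -> (tau == spin_opp tau) = false.
Proof. by case: tau. Qed.

Lemma p_same_gt0 : 0 < p_same.
Proof. by have := p_diff_gt0; rewrite /p_same /p_diff; have := decay_gt0; lra. Qed.

Lemma msg_ge0 z n i j c : adj E i j -> 0 <= msg z n i j c.
Proof.
elim: n i j c => [|n IHn] i j c ij /=; first by rewrite mulr1 p_site_ge0.
rewrite mulr_ge0 ?p_site_ge0 // big_seq prodr_ge0 // => k.
rewrite (mem_children cayleyE) => /andP[jk _]; apply: sumr_ge0 => c' _.
by rewrite mulr_ge0 ?IHn // ltW ?trans_gt0.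
Qed.

Lemma p_site_gt0 c s : (c == Zero) = (s == Zero) -> 0 < p_site t c s.
Proof.
have [->|s0 c0] := eqVneq s Zero; first by rewrite p_site_zero => ->; exact: ltr01.
rewrite p_siteE ?c0 //; case: ifP => _; [exact: p_same_gt0|exact: p_diff_gt0].
Qed.

Lemma msg_eq0 z n i j c : (c == Zero) != (z j == Zero) -> msg z n i j c = 0.
Proof.
move=> h; suff p0 : p_site t c (z j) = 0 by case: n => [|n] /=; rewrite p0 mul0r.
move: h; have [->|zj] := eqVneq (z j) Zero.
  by rewrite p_site_zero; case: (c == Zero).
by rewrite eqbF_neg negbK => /eqP->; rewrite p_zero_site (negPf zj).
Qed.

Lemma branch_gt0_of_msg z n i j a : adj E i j ->
  (forall c, (c == Zero) = (z j == Zero) -> 0 < msg z n i j c) ->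
  0 < branch z n i j a.
Proof.
move=> ij Hc; rewrite /branch (bigD1 (z j)) //= ltr_pwDl //.
  by rewrite mulr_gt0 ?trans_gt0 ?Hc.
by apply: sumr_ge0 => c _; rewrite mulr_ge0 ?msg_ge0 // ltW ?trans_gt0.
Qed.

Lemma msg_gt0 z n i j c : adj E i j -> (c == Zero) = (z j == Zero) ->
  0 < msg z n i j c.
Proof.
elim: n i j c => [|n IHn] i j c ij cz /=; first by rewrite mulr1 p_site_gt0.
rewrite mulr_gt0 ?p_site_gt0 // big_seq prodr_gt0 // => k.
rewrite (mem_children cayleyE) => /andP[jk _].
by apply: branch_gt0_of_msg => // c' cz'; exact: IHn.
Qed.

Lemma branch_gt0 z n i j a : adj E i j -> 0 < branch z n i j a.
Proof. by move=> ij; apply: branch_gt0_of_msg => // c cz; exact: msg_gt0. Qed.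

Lemma branch_vacant z n i j a : z j = Zero ->
  branch z n i j a = trans i j a Zero * msg z n i j Zero.
Proof.
move=> zj; rewrite /branch (bigD1 Zero) //= big1 ?addr0 // => c /negPf c0.
by rewrite msg_eq0 ?mulr0 // zj c0.
Qed.

Lemma branch_occupied z n i j a tau : tau != Zero -> z j != Zero ->
  branch z n i j a = trans i j a tau * msg z n i j tau +
    trans i j a (spin_opp tau) * msg z n i j (spin_opp tau).
Proof.
move=> tau0 zj; have m0 : msg z n i j Zero = 0 by rewrite msg_eq0 // (negPf zj).
by rewrite /branch big_spin /= m0 mulr0 addr0; case: tau tau0 => // _; rewrite addrC.
Qed.

(** An Ising bond transmits a ratio of at least [X^-1] whatever lies below; a vacant child transmits
    ratio 1 by flip symmetry. *)
Lemma branch_ratio_min z n i j tau : adj E i j -> tau != Zero ->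
  X^-1 * branch z n i j (spin_opp tau) <= branch z n i j tau.
Proof.
move=> ij tau0; have Xinv : X^-1 <= 1 by rewrite invf_le1.
have Xinv0 : 0 < X^-1 by rewrite invr_gt0.
have [zj|zj] := eqVneq (z j) Zero.
  rewrite !branch_vacant //.
  have -> : trans i j (spin_opp tau) Zero = trans i j tau Zero.
    by rewrite -[RHS]trans_flip.
  by rewrite ler_piMl // mulr_ge0 ?msg_ge0 // ltW ?trans_gt0.
rewrite !(branch_occupied _ _ _ tau0 zj) trans_cross // trans_flip.
have -> : trans i j (spin_opp tau) tau = X^-1 * trans i j tau tau.
  by rewrite -trans_cross // -[RHS]trans_flip spin_oppK.
have T0 := trans_gt0 tau tau ij.
have m0 := msg_ge0 z n tau ij; have m0' := msg_ge0 z n (spin_opp tau) ij.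
have Tm : 0 <= trans i j tau tau * msg z n i j tau by rewrite mulr_ge0 // ltW.
have Tm' : 0 <= trans i j tau tau * msg z n i j (spin_opp tau).
  by rewrite mulr_ge0 // ltW.
have X2 : X^-1 * X^-1 <= 1 by rewrite mulr_ile1 // ltW.
rewrite mulrDr; apply: lerD.
  by rewrite !mulrA -!(mulrA (X^-1 * X^-1)) ler_piMl.
by rewrite mulrA.
Qed.

Definition amplify (rho : R) := (rho * X + 1) / (rho + X).

(** After clearing denominators the difference of the two sides is a nonnegative multiple of m - rho
    m', with m and m' the messages for [tau] and its opposite. Hence a lower bound [rho] on their
    ratio is enough. *)
Lemma branch_ratio z n i j tau rho : adj E i j -> tau != Zero -> z j != Zero ->
    0 <= rho -> rho * msg z n i j (spin_opp tau) <= msg z n i j tau ->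
  amplify rho * branch z n i j (spin_opp tau) <= branch z n i j tau.
Proof.
move=> ij tau0 zj rho0.
rewrite !(branch_occupied _ _ _ tau0 zj) trans_cross // trans_flip.
have -> : trans i j (spin_opp tau) tau = X^-1 * trans i j tau tau.
  by rewrite -trans_cross // -[RHS]trans_flip spin_oppK.
set T := trans i j tau tau; set m := msg _ _ _ _ tau; set m' := msg _ _ _ _ _ => mm'.
have T0 : 0 < T by exact: trans_gt0.
have rX : 0 < rho + X by exact: ltr_wpDl rho0 X_gt0.
rewrite /amplify mulrAC ler_pdivrMr //.
rewrite -subr_ge0.
have -> : (T * m + X^-1 * T * m') * (rho + X) -
  (rho * X + 1) * (X^-1 * T * m + T * m') = T * (X - X^-1) * (m - rho * m').
  by field; rewrite gt_eqF.
apply: mulr_ge0; last by rewrite subr_ge0.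
apply: mulr_ge0; first exact: ltW.
rewrite subr_ge0; apply: (@le_trans _ _ 1); last exact: X_ge1.
by rewrite invf_le1.
Qed.

(** Two children make up for the loss across an edge. Both sides agree at [rho = 1], so the cleared
    difference has the factor [rho - 1]. *)
Lemma amplify_sqr rho : 1 <= rho <= X -> rho <= amplify rho ^+ 2.
Proof.
move=> /andP[rho1 rhoX].
have rX : 0 < rho + X by exact: ltr_wpDl (le_trans ler01 rho1) X_gt0.
rewrite /amplify expr_div_n ler_pdivlMr ?exprn_gt0 //; have := X_ge16.
move=> X16; rewrite -subr_ge0.
have -> : (rho * X + 1) ^+ 2 - rho * (rho + X) ^+ 2 =
  (rho - 1) * (rho * X ^+ 2 - 2 * rho * X - rho ^+ 2 - rho - 1) by ring.
apply: mulr_ge0; first lra.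
have h1 : rho ^+ 2 <= rho * X by rewrite expr2 ler_pM2l //; lra.
(* By [h1] and [1 <= rho], the second factor is at least this product. *)
have h2 : 0 <= rho * (X * (X - 3) - 2).
  apply: mulr_ge0; first lra.
  by nra.
by nra.
Qed.

Lemma amplify_ge1 rho : 1 <= rho -> 1 <= amplify rho.
Proof.
move=> rho1; have rX : 0 < rho + X by exact: ltr_wpDl (le_trans ler01 rho1) X_gt0.
by rewrite /amplify ler_pdivlMr // mul1r; have := X_ge16; nra.
Qed.

Lemma amplify_X : X / 2 <= amplify X.
Proof.
rewrite /amplify ler_pdivlMr ?addr_gt0 //; have := X_ge16; nra.
Qed.

Lemma prod_branch_ratio z n j tau r (f : V -> R) : tau != Zero ->
    (forall k, k \in r -> adj E j k) ->
    (forall k, k \in r -> 0 <= f k /\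
       f k * branch z n j k (spin_opp tau) <= branch z n j k tau) ->
  (\prod_(k <- r) f k) * \prod_(k <- r) branch z n j k (spin_opp tau) <=
  \prod_(k <- r) branch z n j k tau.
Proof.
move=> tau0 jr H; rewrite -big_split /= big_seq [leRHS]big_seq.
apply: ler_prod => k kr; have [f0 ->] := H k kr; rewrite andbT.
by rewrite mulr_ge0 // ltW // branch_gt0 // jr.
Qed.

Lemma p_site_ratio tau s : tau != Zero -> s != Zero ->
  2^-1 * p_site t (spin_opp tau) s <= p_site t tau s.
Proof.
move=> tau0 s0; have pd := p_diff_gt0; have ps := p_same_le.
have -> : p_site t (spin_opp tau) s = if s == tau then p_diff else p_same.
  rewrite p_siteE ?opp_neq0 //; case: (occupied_cases tau0 s0) => ->.
    by rewrite eqxx spin_opp_neq.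
  by rewrite eqxx eq_sym spin_opp_neq.
rewrite p_siteE //; case: ifP => _; last lra.
by move: pd ps; rewrite /p_same /p_diff; have := decay_gt0; lra.
Qed.

Lemma p_site_theta tau : tau != Zero ->
  theta * p_site t (spin_opp tau) tau = p_site t tau tau.
Proof.
move=> tau0; rewrite !p_siteE ?opp_neq0 // eqxx spin_opp_neq //.
by rewrite /theta divfK // gt_eqF // p_diff_gt0.
Qed.

Lemma msgS z n i j c : msg z n.+1 i j c =
  p_site t c (z j) * \prod_(k <- children E i j) branch z n j k c.
Proof. by []. Qed.

(* Since [amplify rho ^+ 2 >= rho], each level gains the factor [theta] of the
   homogeneous field, until the threshold [X] is reached. *)
Lemma outer_ratio z n i j tau : adj E i j -> tau != Zero ->
    (forall v, v \in desc E n i j -> z v = tau) ->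
  Num.min (theta ^+ n.+1) X * msg z n i j (spin_opp tau) <= msg z n i j tau.
Proof.
elim: n i j => [|n IHn] i j ij tau0 zt.
  rewrite /= zt ?mem_head // !mulr1 expr1 -p_site_theta //.
  by rewrite ler_wpM2r ?p_site_ge0 // ge_min lexx.
rewrite !msgS zt ?mem_head // -[p_site t tau tau]p_site_theta //.
rewrite mulrCA -mulrA [leRHS]mulrCA ler_wpM2l ?p_site_ge0 //.
set rho := Num.min (theta ^+ n.+1) X.
have theta1 := theta_gt1.
have rho1X : 1 <= rho <= X.
  rewrite le_min exprn_ege1 ?(ltW theta1) //= ge_min lexx orbT andbT.
  exact: X_ge1.
have /andP[rho1 rhoX] := rho1X.
have H := @prod_branch_ratio z n j tau (children E i j) (fun=> amplify rho) tau0.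
have {H} : amplify rho ^+ d *
   \prod_(k <- children E i j) branch z n j k (spin_opp tau) <=
   \prod_(k <- children E i j) branch z n j k tau.
  rewrite -(size_children cayleyE ij).
  have -> : amplify rho ^+ size (children E i j) =
      \prod_(k <- children E i j) amplify rho.
    by rewrite big_const_seq count_predT iter_mulr_1.
  apply: H => k; rewrite (mem_children cayleyE) => /andP[jk ki] //.
  have zk v : v \in desc E n j k -> z v = tau.
    move=> vk; apply: zt; rewrite in_cons; apply/orP; right.
    by apply/flatten_mapP; exists k; rewrite // (mem_children cayleyE) jk.
  split; first by rewrite (le_trans ler01) // amplify_ge1.
  apply: branch_ratio => //; last exact: IHn.
    by rewrite zk //; case: (n) => [|?]; exact: mem_head.
  exact: le_trans rho1.
set B' := \prod_(k <- _) branch _ _ _ _ (spin_opp tau).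
move=> H; apply: le_trans _ (ler_wpM2l (ltW (lt_trans ltr01 theta1)) H).
have B'0 : 0 <= B'.
  rewrite /B' big_seq prodr_ge0 // => k.
  by rewrite (mem_children cayleyE) => /andP[jk _]; rewrite ltW // branch_gt0.
rewrite mulrA ler_wpM2r //.
have amp : rho <= amplify rho ^+ d.
  apply: le_trans (amplify_sqr rho1X) _; rewrite ler_weXn2l ?amplify_ge1 //.
  exact: leq_trans d_ge4.
(* The root's field multiplies the minimum by [theta]: its first entry becomes the next power and
   its second stays above [X]. *)
apply: (@le_trans _ _ (theta * rho)); last by rewrite ler_pM2l // (lt_trans ltr01).
rewrite /rho minr_pMr ?(ltW (lt_trans ltr01 theta1)) // -exprS.
by rewrite le_min ge_min lexx /= ge_min ler_peMl ?orbT // ltW.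
Qed.

(** The vertex [j] and its other branches lie beyond the edge to [k], so a vertex below [k] can only
    be reached through [k]. This locates where the boundary condition begins inside each branch. *)
Lemma level_flatten n m j k r v : {subset r <= nbr E j} -> k \in r ->
    v \in desc E m j k -> v \in j :: flatten [seq desc E n j k' | k' <- r] ->
  v \in desc E n j k.
Proof.
move=> rN kr vk.
have jr k' : k' \in r -> adj E j k' by move/rN; rewrite (mem_nbr cayleyE).
rewrite in_cons => /predU1P[vj|/flatten_mapP[k' k'r vk']].
  have := desc_disjoint cayleyE m (jr _ kr) (past_self cayleyE (jr _ kr)).
  by rewrite vj in vk; rewrite vk.
have [<-//|k'k] := eqVneq k' k.
have := desc_sibling cayleyE (jr _ kr) (jr _ k'r) k'k vk'.
by move=> /(desc_disjoint cayleyE m (jr _ kr)); rewrite vk.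
Qed.

Lemma mem_desc_root n i j : j \in desc E n i j.
Proof. by case: n => [|n]; exact: mem_head. Qed.

Lemma mem_desc_child n i j k v : k \in children E i j -> v \in desc E n j k ->
  v \in desc E n.+1 i j.
Proof.
by move=> ck vk; rewrite in_cons; apply/orP; right; apply/flatten_mapP; exists k.
Qed.

(* [z] is the typical configuration [eta] down to depth [n] and the boundary
   condition [tau] on the [m + 1] levels below. *)
Definition seed_below eta z tau n m i j :=
  {in desc E n i j, z =1 eta} /\
  (forall v, v \in desc E (n + m).+1 i j -> v \notin desc E n i j -> z v = tau).

Lemma seed_child eta z tau n m i j k : k \in children E i j ->
  seed_below eta z tau n.+1 m i j -> seed_below eta z tau n m j k.
Proof.
move=> ck [zeta ztau]; split=> [v vk|v vk nvk].
  by apply: zeta; exact: mem_desc_child vk.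
apply: ztau; first by rewrite addSn; exact: mem_desc_child vk.
apply: contra nvk; apply: level_flatten vk => //.
by move=> x; rewrite mem_filter => /andP[].
Qed.

(** A homogeneous subtree of depth [m] is deep enough for the minimum in [outer_ratio] to be [X]. *)
Definition reach m := X <= theta ^+ m.+1.

Lemma exists_reach : exists m, reach m.
Proof.
have t1 := theta_gt1; pose h := theta - 1.
have h0 : 0 < h by rewrite subr_gt0.
have bern n : 1 + n%:R * h <= theta ^+ n.
  elim: n => [|n IHn]; first by rewrite mul0r addr0.
  rewrite exprSr; apply: le_trans (ler_wpM2r (ltW (lt_trans ltr01 t1)) IHn).
  have -> : theta = 1 + h by rewrite addrC subrK.
  rewrite -natr1 -subr_ge0.
  have -> : (1 + n%:R * h) * (1 + h) - (1 + (n%:R + 1) * h) = n%:R * h ^+ 2 by ring.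
  by rewrite mulr_ge0 // exprn_ge0 // ltW.
(* With this [m], (m + 1) h exceeds [X], and Bernoulli's inequality [bern] applies. *)
pose m := Num.truncn (X / h).
exists m; apply: le_trans (bern m.+1); apply: ler_wpDl => //.
rewrite -ler_pdivrMr //; apply: ltW; exact: truncnS_gt.
Qed.

(** Each good child contributes at least [amplify X >= X / 2], the exceptional one at least
    [X^-1]. *)
Lemma prod_branch_one_exception z n j tau r (b : V -> bool) : tau != Zero ->
    uniq r -> (0 < size r)%N -> (forall k, k \in r -> adj E j k) ->
    (forall k k', k \in r -> k' \in r -> b k -> b k' -> k' = k) ->
    (forall k, k \in r -> ~~ b k -> z k != Zero /\
       X * msg z n j k (spin_opp tau) <= msg z n j k tau) ->
  X^-1 * (X / 2) ^+ (size r).-1 *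
    \prod_(k <- r) branch z n j k (spin_opp tau) <=
  \prod_(k <- r) branch z n j k tau.
Proof.
move=> tau0 ur r0 jr b1 H.
have B0 : 0 <= \prod_(k <- r) branch z n j k (spin_opp tau).
  by rewrite big_seq prodr_ge0 // => k /jr jk; rewrite ltW // branch_gt0.
have X2 : 1 <= X / 2 by rewrite ler_pdivlMr //; have := X_ge16; lra.
have Xinv : 0 <= X^-1 <= 1 by rewrite invr_ge0 ltW //= invf_le1.
apply: le_trans (ler_wpM2r B0 (prod_one_exception Xinv X2 ur r0 b1)) _.
apply: prod_branch_ratio => // k kr; case: ifP => bk.
  by split; [rewrite invr_ge0 ltW|apply: branch_ratio_min; rewrite ?jr].
have [zk Hk] := H k kr (negbT bk).
split; first by rewrite divr_ge0 // ltW.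
apply: le_trans (branch_ratio _ tau0 zk _ Hk); rewrite ?jr //; last exact: ltW.
by rewrite ler_wpM2r ?amplify_X // ltW // branch_gt0 ?jr.
Qed.

(** Here [d >= 4] and [X >= 16] meet: three good children against one exception give (X/2)^3 / X =
    X^2 / 8 >= 2 X. The extra 2 pays for the field at [j] in [vertex_ratio]. *)
Lemma prod_branch_children z n i j tau (b : V -> bool) : adj E i j -> tau != Zero ->
    (forall k k', k \in children E i j -> k' \in children E i j ->
       b k -> b k' -> k' = k) ->
    (forall k, k \in children E i j -> ~~ b k -> z k != Zero /\
       X * msg z n j k (spin_opp tau) <= msg z n j k tau) ->
  2 * X * \prod_(k <- children E i j) branch z n j k (spin_opp tau) <=
  \prod_(k <- children E i j) branch z n j k tau.
Proof.
move=> ij tau0 b1 H; have szr := size_children cayleyE ij.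
have jr k : k \in children E i j -> adj E j k.
  by rewrite (mem_children cayleyE) => /andP[].
apply: le_trans (prod_branch_one_exception tau0 (uniq_children E i j) _ jr b1 H).
  rewrite ler_wpM2r //.
    by rewrite big_seq prodr_ge0 // => k /jr jk; rewrite ltW // branch_gt0.
  have X16 := X_ge16; have X2 : 1 <= X / 2 by rewrite ler_pdivlMr //; lra.
  have X3 : (X / 2) ^+ 3 <= (X / 2) ^+ (size (children E i j)).-1.
    by rewrite ler_weXn2l // szr; case: (d) d_ge4.
  rewrite [leRHS]mulrC ler_pdivlMr //; apply: le_trans X3.
  by rewrite !exprS expr0; nra.
by rewrite szr; exact: leq_trans d_ge4.
Qed.

Lemma vertex_ratio z n i j tau (b : V -> bool) : adj E i j -> tau != Zero ->
    z j != Zero ->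
    (forall k k', k \in children E i j -> k' \in children E i j ->
       b k -> b k' -> k' = k) ->
    (forall k, k \in children E i j -> ~~ b k -> z k != Zero /\
       X * msg z n j k (spin_opp tau) <= msg z n j k tau) ->
  X * msg z n.+1 i j (spin_opp tau) <= msg z n.+1 i j tau.
Proof.
move=> ij tau0 zj b1 H; rewrite !msgS.
have := prod_branch_children ij tau0 b1 H.
set B' := \prod_(k <- _) branch _ _ _ _ (spin_opp tau).
have B'0 : 0 <= B'.
  rewrite /B' big_seq prodr_ge0 // => k.
  by rewrite (mem_children cayleyE) => /andP[jk _]; rewrite ltW // branch_gt0.
have p0 := p_site_ge0 t_ge0 (spin_opp tau) (z j).
move=> BB; apply: le_trans (ler_pM _ _ (p_site_ratio tau0 zj) BB).
- by rewrite [leRHS](_ : _ = X * (p_site t (spin_opp tau) (z j) * B')) //; field.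
- by rewrite mulr_ge0.
- by rewrite mulr_ge0 // mulr_ge0 // ltW.
Qed.

(** The ratio [X] is created in the homogeneous annulus, and [vertex_ratio] carries it up to [j],
    since a vertex that does not fail has at most one failing child. *)
Lemma good_ratio eta z tau n m i j : adj E i j -> tau != Zero -> reach m ->
    ~ fail E n i j eta -> seed_below eta z tau n m i j ->
  z j != Zero /\
  X * msg z (n + m).+1 i j (spin_opp tau) <= msg z (n + m).+1 i j tau.
Proof.
move=> ij tau0 rm; elim: n i j ij => [|n IHn] i j ij nfail seed.
  have zj : z j != Zero.
    have [zeta _] := seed; rewrite zeta ?mem_desc_root //.
    by apply/eqP => ej; apply: nfail.
  split=> //; rewrite add0n.
  (* Every child starts [m + 1] levels of pure [tau], so there is no exception. *)
  apply: (@vertex_ratio _ _ _ _ _ (fun=> false)) => // k ck _.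
  have [jk ki] : adj E j k /\ k != i.
    by move: ck; rewrite (mem_children cayleyE) => /andP[].
  have zk v : v \in desc E m j k -> z v = tau.
    move=> vk; case: seed => _; apply; first by rewrite add0n; exact: mem_desc_child vk.
    rewrite mem_seq1; apply: contraTneq vk => ->.
    exact: (desc_disjoint cayleyE m jk (past_self cayleyE jk)).
  split; first by rewrite zk // mem_desc_root.
  apply: le_trans (outer_ratio jk tau0 zk); rewrite ler_wpM2r ?msg_ge0 //.
  by rewrite le_min lexx andbT; exact: rm.
have zj : z j != Zero.
  have [zeta _] := seed; rewrite zeta ?mem_desc_root //.
  by apply/eqP => ej; apply: nfail; left.
split=> //; pose b k := `[< fail E n j k eta >].
rewrite addSn; apply: (@vertex_ratio _ _ _ _ _ b) => //.
  move=> k k' ck ck' /asboolP fk /asboolP fk'; apply: contra_notP nfail => /eqP k'k.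
  by right; exists k => //; split=> //; exists k'; rewrite // mem_filter k'k.
move=> k ck /asboolPn nfk; apply: IHn => //; last exact: seed_child seed.
by move: ck; rewrite (mem_children cayleyE) => /andP[].
Qed.

(* The edge from [u] to [i] may carry any message: with at most one failing
   child, [d - 1 >= 3] good ones still dominate. *)
Lemma root_ratio eta z tau n m i u : adj E i u -> tau != Zero -> reach m ->
    ~ fail E n.+1 i u eta ->
    (forall k, k \in children E i u -> seed_below eta z tau n m u k) ->
  2 * \prod_(k <- nbr E u) branch z (n + m).+1 u k (spin_opp tau) <=
  \prod_(k <- nbr E u) branch z (n + m).+1 u k tau.
Proof.
move=> iu tau0 rm nfail seed; pose b k := `[< fail E n u k eta >].
have adjs k : k \in children E i u -> adj E u k.
  by rewrite (mem_children cayleyE) => /andP[].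
have ui : adj E u i by rewrite adjC.
have perm a : \prod_(k <- nbr E u) branch z (n + m).+1 u k a =
    branch z (n + m).+1 u i a * \prod_(k <- children E i u) branch z (n + m).+1 u k a.
  by rewrite (perm_big _ (perm_nbr cayleyE iu)) big_cons.
have Xinv : 0 <= X^-1 by rewrite invr_ge0 ltW.
have B0 : 0 <= \prod_(k <- children E i u) branch z (n + m).+1 u k (spin_opp tau).
  by rewrite big_seq prodr_ge0 // => k /adjs jk; rewrite ltW // branch_gt0.
(* The back edge costs at most [X^-1] and the children gain [2 * X]. *)
rewrite !perm; apply: le_trans (ler_pM _ _ (branch_ratio_min z (n + m).+1 ui tau0)
  (prod_branch_children (b := b) iu tau0 _ _)).
- rewrite -subr_ge0; set x := branch _ _ _ _ _; set y := \prod_(k <- _) _.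
  by rewrite (_ : _ - _ = 0) //; field; rewrite gt_eqF.
- by rewrite mulr_ge0 // ltW // branch_gt0.
- by rewrite mulr_ge0 // mulr_ge0 // ltW.
- move=> k k' ck ck' /asboolP fk /asboolP fk'; apply: contra_notP nfail => /eqP k'k.
  by right; exists k => //; split=> //; exists k'; rewrite // mem_filter k'k.
move=> k ck /asboolPn nfk; apply: (good_ratio (adjs _ ck) tau0 rm nfk).
exact: seed.
Qed.

End Contraction.

(** * Measurability of the set of bad configurations *)

Section BadMeasurable.
Variables (V : choiceType) (R : realType) (nu : probability (Omega V) R).
Implicit Types (L D : {fset V}) (eta xi : V -> spin) (f g : Omega V -> R).

Lemma countable_fsets : countable [set: V] -> countable [set: {fset V}].
Proof.
move=> /countable_injP[h hinj]; apply/countable_injP.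
exists (fun L => choice.pickle (h @` L)%fset) => L L' _ _.
move=> /(pcan_inj choice.pickleK)/fsetP hLL'.
have inj : injective h by move=> u v huv; apply: hinj; rewrite ?inE.
by apply/fsetP => v; have := hLL' (h v); rewrite !mem_imfset.
Qed.

Lemma localP f : Defs.local f <-> exists L, forall w w' : Omega V,
  (forall v, v \in L -> w v = w' v) -> f w = f w'.
Proof.
split=> [[L mf]|[L Lf]]; exists L.
  move=> w w' ww'; have := mf measurableT [set f w] (measurable_set1 _).
  rewrite setTI => FA; have [+ _] := @F_determined V [set` L] _ FA w w' ww'.
  by move=> /(_ erefl) ->.
move=> _ A mA; rewrite setTI; apply: (@determined_F V [set` L] L) => // w w' ww' /=.
by rewrite (Lf w w').
Qed.

(* The limsup of the oscillation vanishes, see [limsup_gt0]. *)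
Definition settled f L0 eta := forall e : R, 0 < e -> exists L1,
  forall L, (L1 `<=` L)%fset -> forall xi1 xi2 D, (L `<=` D)%fset ->
    `|cond_mean_at nu f L0 L D eta xi1 - cond_mean_at nu f L0 L D eta xi2| <= e.

Lemma limsup_gt0 f L0 eta :
  (0 < limsup_fset (oscillation nu f L0 eta))%E <-> ~ settled f L0 eta.
Proof.
split=> [lim_gt0 set|nset].
  have [e e0 elt] : exists2 e : R, 0 < e &
      (e%:E < limsup_fset (oscillation nu f L0 eta))%E.
    case: (limsup_fset _) lim_gt0 => [r| |] //.
      by rewrite lte_fin => r0; exists (r / 2); rewrite ?lte_fin; lra.
    by move=> _; exists 1; rewrite // ltry.
  have [L1 HL1] := set e e0.
  move: elt; rewrite ltNge => /negP; apply.
  apply: ge_ereal_inf; exists (ereal_sup [set oscillation nu f L0 eta L | L in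
      [set L | (L1 `<=` L)%fset]]); first by exists L1.
  apply: ge_ereal_sup => _ [L /= LL1 <-]; apply: ge_ereal_sup.
  by move=> _ [xi1 [xi2 [D [LD ->]]]]; rewrite lee_fin HL1.
have [e [e0 He]] : exists e : R, 0 < e /\ forall L1, exists2 L, (L1 `<=` L)%fset &
    exists xi1 xi2 D, (L `<=` D)%fset /\
    e < `|cond_mean_at nu f L0 L D eta xi1 - cond_mean_at nu f L0 L D eta xi2|.
  apply: contrapT => H; apply: nset => e e0; apply: contrapT => H1; apply: H.
  exists e; split=> // L1; apply: contrapT => H2; apply: H1; exists L1.
  move=> L L1L xi1 xi2 D LD; rewrite leNgt; apply/negP => H3; apply: H2.
  by exists L => //; exists xi1, xi2, D.
apply: (@lt_le_trans _ _ e%:E); rewrite ?lte_fin //.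
apply: le_ereal_inf_tmp => _ [L1 _ <-]; have [L L1L [xi1 [xi2 [D [LD eD]]]]] := He L1.
apply: (@le_trans _ _ (oscillation nu f L0 eta L)); last first.
  by apply: ereal_sup_ubound; exists L.
apply: le_ereal_sup_tmp; eexists; first by exists xi1, xi2, D; split.
by rewrite lee_fin ltW.
Qed.

(** The tolerances can be taken of the form 1 / (q + 1) and the finite sets are countably many. The
    event [O q L] quantifies over uncountably many boundary conditions, but depends on [eta] only
    inside [L]. *)
Lemma measurable_unsettled f L0 : countable [set: V] ->
  measurable ([set eta | ~ settled f L0 eta] : set (Omega V)).
Proof.
move=> cV; have cF := countable_fsets cV.
pose O q L : set (Omega V) := [set eta | exists xi1 xi2 D, (L `<=` D)%fset /\
  q.+1%:R^-1 < `|cond_mean_at nu f L0 L D eta xi1 - cond_mean_at nu f L0 L D eta xi2|].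
have mO q L : measurable (O q L).
  apply: (@F_measurable _ setT); apply: (@determined_F _ _ L) => // w w' ww'.
  move=> [xi1 [xi2 [D [LD H]]]]; exists xi1, xi2, D; split=> //.
  have sp xi : splice L w' xi = splice L w xi.
    by apply/funext => v; rewrite /splice; case: ifP => // /ww'.
  by rewrite /cond_mean_at !sp.
have -> : [set eta | ~ settled f L0 eta] =
  \bigcup_q ~` (\bigcup_L1 ~` (\bigcup_L (if (L1 `<=` L)%fset then O q L else set0))).
  apply/seteqP; split=> eta.
    move=> nset; apply: contrapT => H; apply: nset => e e0.
    pose q := Num.truncn e^-1.
    have qe : q.+1%:R^-1 <= e.
      by rewrite invf_ple ?posrE ?ltr0n // ltW // truncnS_gt.
    apply: contrapT => nL1; apply: H; exists q => // -[L1 _ nU]; apply: nL1.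
    exists L1 => L L1L xi1 xi2 D LD; rewrite leNgt; apply/negP => H; apply: nU.
    exists L => //; rewrite L1L; exists xi1, xi2, D; split=> //.
    exact: le_lt_trans H.
  move=> [q _ H] set; have [L1 HL1] := set q.+1%:R^-1 (ltac:(by rewrite invr_gt0)).
  apply: H; exists L1 => // -[L _]; case: ifP => // L1L [xi1 [xi2 [D [LD]]]].
  by rewrite ltNge HL1.
apply: bigcupT_measurable => q; apply: measurableC.
apply: countable_bigcupT_measurable => // L1; apply: measurableC.
by apply: countable_bigcupT_measurable => // L; case: ifP.
Qed.

(** Integrability makes conditional means linear, so this property passes to linear combinations. *)
Definition fsettled f L0 eta := nu.-integrable setT (EFin \o f) /\ settled f L0 eta.

Lemma measurable_agree L z : measurable (agree L z).
Proof. exact: (measurable_agr L z). Qed.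

Lemma fsettledD f g L0 eta c : fsettled f L0 eta -> fsettled g L0 eta ->
  fsettled (fun w => f w + c * g w) L0 eta.
Proof.
move=> [intf sf] [intg sg].
have intcg : nu.-integrable setT (EFin \o (fun w => c * g w)).
  exact: (integrableZl measurableT c intg).
split; first exact: (integrableD measurableT intf intcg).
have cmE L D xi : cond_mean_at nu (fun w => f w + c * g w) L0 L D eta xi =
    cond_mean_at nu f L0 L D eta xi + c * cond_mean_at nu g L0 L D eta xi.
  rewrite /cond_mean_at /cond_mean; set A := agree _ _.
  have mA : measurable A by exact: measurable_agree.
  have iS h : nu.-integrable setT (EFin \o h) -> nu.-integrable A (EFin \o h).
    by move=> ih; apply: integrableS ih.
  rewrite RintegralD ?iS // RintegralZl ?iS // mulrDl mulrA //.
(* Chosen so that (1 + |c|) e' = e / 2. *)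
move=> e e0; pose e' := e / (2 * (1 + `|c|)).
have c1 : 0 < 1 + `|c| by rewrite ltr_wpDr.
have e'0 : 0 < e' by rewrite divr_gt0 ?mulr_gt0.
have [L1 H1] := sf e' e'0; have [L2 H2] := sg e' e'0.
exists (L1 `|` L2)%fset => L; rewrite fsubUset => /andP[L1L L2L] xi1 xi2 D LD.
rewrite !cmE; have := H1 L L1L xi1 xi2 D LD; have := H2 L L2L xi1 xi2 D LD.
set a := cond_mean_at nu f _ _ _ _ xi1; set b := cond_mean_at nu f _ _ _ _ xi2.
set a' := cond_mean_at nu g _ _ _ _ xi1; set b' := cond_mean_at nu g _ _ _ _ xi2.
move=> ab' ab.
have -> : a + c * a' - (b + c * b') = (a - b) + c * (a' - b') by ring.
apply: le_trans (ler_normD _ _) _; rewrite normrM.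
apply: (@le_trans _ _ (e' + `|c| * e')).
  by rewrite lerD // ler_wpM2l.
rewrite (_ : e' + `|c| * e' = e / 2); first lra.
by rewrite /e'; field; rewrite gt_eqF.
Qed.

(** A local function is a finite combination of indicators of patterns on [L]. This replaces the
    uncountable choice of [f] in [bad] by a countable one. *)
Lemma unsettled_indic f L0 eta L : ~ settled f L0 eta ->
    (forall w w' : Omega V, (forall v, v \in L -> w v = w' v) -> f w = f w') ->
  exists x : {ffun L -> spin},
    ~ settled (\1_(agree L (Defs.glue x (fun=> Zero)))) L0 eta.
Proof.
move=> nset Lf; apply: contrapT => H; apply: nset.
(* Vacancy outside [L] is a default value; [f] and [agree L] look only inside [L]. *)
pose ex (x : {ffun L -> spin}) := Defs.glue x (fun=> Zero).
have Hx x : settled (\1_(agree L (ex x))) L0 eta.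
  by apply: contrapT => nx; apply: H; exists x.
have fE : f = fun w => \sum_(x : {ffun L -> spin}) f (ex x) * \1_(agree L (ex x)) w.
  apply/funext => w; pose x0 : {ffun L -> spin} := [ffun k => w (val k)].
  have x0w v : v \in L -> w v = ex x0 v.
    by move=> vL; rewrite /ex /Defs.glue insubT ffunE.
  rewrite (bigD1 x0) //= big1 => [|x xx0].
    by rewrite addr0 indicE mem_set ?mulr1 //; exact: Lf.
  rewrite indicE memNset ?mulr0 // => wx; case/eqP: xx0; apply/ffunP => k.
  rewrite ffunE wx ?(valP k) // /ex /Defs.glue insubT ?(valP k) // => h.
  by congr (x _); exact/val_inj.
suff Hs (r : seq {ffun L -> spin}) :
    fsettled (fun w => \sum_(x <- r) f (ex x) * \1_(agree L (ex x)) w) L0 eta.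
  by rewrite fE; have [] := Hs (index_enum _).
elim: r => [|x r IHr].
  rewrite (_ : (fun w : Omega V => _) = cst 0); last first.
    by apply/funext => w; rewrite big_nil.
  split; first exact: integrable0.
  move=> e e0; exists fset0 => L' _ xi1 xi2 D _.
  rewrite /cond_mean_at /cond_mean !Rintegral_cst ?mul0r ?subrr ?normr0 ?ltW //.
  - exact: measurable_agree.
  - exact: measurable_agree.
rewrite (_ : (fun w : Omega V => _) = fun w =>
    \sum_(x' <- r) f (ex x') * \1_(agree L (ex x')) w +
    f (ex x) * \1_(agree L (ex x)) w); last first.
  by apply/funext => w; rewrite big_cons addrC.
apply: fsettledD => //; split; last exact: Hx.
by apply: integrable_indic; exact: measurable_agree.
Qed.

Lemma measurable_bad : countable [set: V] ->
  measurable ([set eta | bad nu eta] : set (Omega V)).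
Proof.
move=> cV; have cF := countable_fsets cV.
pose U L0 L (x : {ffun L -> spin}) : set (Omega V) :=
  [set eta | ~ settled (\1_(agree L (Defs.glue x (fun=> Zero)))) L0 eta].
have -> : [set eta | bad nu eta] =
    \bigcup_(L0 : {fset V}) \bigcup_(L : {fset V})
      \bigcup_(x : {ffun L -> spin}) U L0 L x.
  apply/seteqP; split=> eta.
    move=> [f [L0 [/localP[L Lf] /limsup_gt0 nset]]].
    have [x nx] := unsettled_indic nset Lf.
    by exists L0 => //; exists L => //; exists x.
  move=> [L0 _ [L _ [x _ nx]]].
  exists (\1_(agree L (Defs.glue x (fun=> Zero)))), L0; split; last exact/limsup_gt0.
  apply/localP; exists L => w w' ww'; rewrite !indicE; congr ((nat_of_bool _)%:R).
  by apply/idP/idP => /set_mem wx; apply/mem_set => v vL; rewrite -wx // ww'.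
apply: countable_bigcupT_measurable => // L0.
apply: countable_bigcupT_measurable => // L.
apply: fin_bigcup_measurable => // x _.
exact: measurable_unsettled.
Qed.

End BadMeasurable.

(** * Discontinuity *)

Section Occupation.
Variables (V : choiceType) (E : set {fset V}).

Lemma occupation_fail n i j : occupation_set (fail E n i j).
Proof.
elim: n i j => [|n IHn] i j w w' ww'.
  by rewrite /= /at_ /= => /eqP; rewrite ww' => /eqP.
move=> [wj|[k ck [fk [k' ck' fk']]]].
  by left; move: wj; rewrite /at_ /= => /eqP; rewrite ww' => /eqP.
right; exists k => //; split; first exact: IHn fk.
by exists k' => //; exact: IHn fk'.
Qed.

Lemma occupation_fail_ever i j : occupation_set (fail_ever E i j).
Proof. by move=> w w' ww' [n _ fn]; exists n => //; exact: occupation_fail fn. Qed.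

Lemma occupation_fail_around n i j : occupation_set (fail_around E n i j).
Proof.
elim: n i j => [|n IHn] i j; first exact: occupation_fail_ever.
rewrite /=; case: children => [|k [|k' r]] // w w' ww' [fk fk'].
by split; [exact: occupation_fail_ever fk|exact: IHn fk'].
Qed.

End Occupation.

Lemma le_half_exprn_eq0 (R : archiRealFieldType) (x : R) : 0 <= x ->
  (forall n, x <= 2^-1 ^+ n) -> x = 0.
Proof.
move=> x0 xle; apply/eqP; rewrite eq_le x0 andbT leNgt; apply/negP => xpos.
pose n := Num.truncn x^-1.
have : x^-1 < 2 ^+ n.
  apply: lt_le_trans (truncnS_gt _) _; rewrite -natrX ler_nat.
  exact: ltn_expl.
have := xle n; rewrite exprVn => /le_lt_trans H.
rewrite -[2 ^+ n]invrK ltf_pV2 ?posrE ?invr_gt0 ?exprn_gt0 //.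
by move=> /H; rewrite ltxx.
Qed.

Section Discontinuity.
Variables (R : realType) (d : nat) (V : choiceType) (E : set {fset V}).
Hypotheses (d_ge4 : (4 <= d)%N) (cayleyE : cayley_tree d E).
Variables (beta t la : R).
Hypotheses (beta_gt16 : 16 < beta) (t_ge1 : 1 <= t).
Hypothesis la_ge : 4 * d%:R ^+ 2 * 2 ^+ d <= la.
Variables mu mut : probability (Omega V) R.
Hypotheses (gibbs_mu : gibbs E beta la mu) (markov_mu : tree_markov_chain E mu).
Hypotheses (flip_mu : flip_invariant mu) (evolved : time_evolved t mu mut).

Let t_ge0 : 0 <= t. Proof. exact: le_trans t_ge1. Qed.

Let d_gt0 : (0 : R) < d%:R. Proof. by rewrite ltr0n (leq_trans _ d_ge4). Qed.

Let la_gt0 : 0 < la.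
Proof. by apply: lt_le_trans la_ge; rewrite !mulr_gt0 ?exprn_gt0. Qed.

Let X := expR beta.

Let X_ge16 : 16 <= X.
Proof.
apply: le_trans (expR_ge1Dx beta); have := beta_gt16; lra.
Qed.

Let tr_gt0 i j a s : adj E i j -> 0 < trans mu i j a s.
Proof. exact: (trans_gt0 cayleyE la_gt0 gibbs_mu). Qed.

Let tr_flip i j a s :
  trans mu i j (spin_opp a) (spin_opp s) = trans mu i j a s.
Proof. exact: trans_flip. Qed.

Let tr_cross i j a : adj E i j -> a != Zero ->
  trans mu i j a (spin_opp a) = X^-1 * trans mu i j a a.
Proof.
move=> ij a0; rewrite -expRN.
exact: (trans_cross cayleyE la_gt0 gibbs_mu markov_mu flip_mu).
Qed.

Let mk_trans i j a s (B : set (Omega V)) : adj E i j ->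
  F (past E i j) B -> B `<=` at_ i a ->
  pr mu (B `&` at_ j s) = trans mu i j a s * pr mu B.
Proof. exact: (markov_trans cayleyE la_gt0 gibbs_mu markov_mu). Qed.

Let eps : R := 2 ^+ d / la.

(** Split by the spin at the parent [i]; the vacancy bound is uniform in it. *)
Let zero_le i j (B : set (Omega V)) : adj E i j -> F (past E i j) B ->
  pr mu (B `&` at_ j Zero) <= eps * pr mu B.
Proof.
move=> ij FB; have mB := F_measurable FB.
rewrite (pr_split mu i (B := B `&` at_ j Zero)); last first.
  by apply: measurableI => //; exact: measurable_at.
rewrite [in leRHS](pr_split mu i mB) mulr_sumr; apply: ler_sum => a _.
rewrite setIAC (@mk_trans i j a Zero) //.
- rewrite ler_wpM2r ?pr_ge0 //.
  exact: (trans_zero_small cayleyE la_gt0 gibbs_mu markov_mu flip_mu).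
- by apply: F_setI => //; apply: F_at; exact: (past_self cayleyE).
Qed.

Notation branch := (branch E t mu).

(** The joint probability of the initial spin [a] at [u] and the evolved pattern [z] on the ball
    without [u]. *)
Definition root_weight z n u a : R :=
  pr mu (at_ u a) * \prod_(k <- nbr E u) branch z n u k a.

Lemma root_weight_gt0 z n u a : 0 < root_weight z n u a.
Proof.
rewrite mulr_gt0 ?(pr_at_gt0 cayleyE la_gt0 gibbs_mu) // big_seq prodr_gt0 // => k.
by rewrite (mem_nbr cayleyE) => uk; apply: (branch_gt0 cayleyE t_ge1 tr_gt0).
Qed.

(** No branch contains [u], so the prescribed value there enters only the root factor. *)
Lemma pr_mut_ball z n u s (D : {fset V}) : D =i tree_ball E n u ->
  pr mut (agree (D `\ u)%fset z `&` at_ u s) =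
  \sum_(a : spin) p_site t a s * root_weight z n u a.
Proof.
move=> Db; have -> : agree (D `\ u)%fset z `&` at_ u s = agree D (upd z u s).
  apply/seteqP; split=> w.
    move=> [wz wu] v vD; rewrite /upd; case: eqP => [->//|/eqP vu].
    by apply: wz; rewrite !inE vu.
  move=> wz; split=> [v|]; last by rewrite /at_ /= wz ?Db ?mem_head // /upd eqxx.
  by rewrite !inE => /andP[/negPf vu vD]; rewrite wz // /upd vu.
transitivity (wint t mu (upd z u s) (tree_ball E n u) setT).
  by rewrite /pr (mut_agree t_ge0 evolved _ (uniq_tree_ball cayleyE n u) Db).
rewrite (wint_tree_ball cayleyE t mk_trans) /upd eqxx; apply: eq_bigr => a _.
congr (_ * (_ * _)); rewrite big_seq [RHS]big_seq; apply: eq_bigr => k.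
rewrite (mem_nbr cayleyE) => uk; apply: eq_branch => v vk.
case: eqP => // vu; move: vk; rewrite vu.
by rewrite (negPf (desc_disjoint cayleyE n uk (past_self cayleyE uk))).
Qed.

Definition magnetization u (w : Omega V) : R :=
  \1_(at_ u Plus) w + (- 1) * \1_(at_ u Minus) w.

Lemma Rintegral_magnetization u (A : set (Omega V)) : measurable A ->
  Rintegral mut A (magnetization u) =
  pr mut (A `&` at_ u Plus) - pr mut (A `&` at_ u Minus).
Proof.
move=> mA; have mat s : measurable (at_ u s : set (Omega V)) by exact: measurable_at.
have int s : mut.-integrable A (EFin \o \1_(at_ u s)).
  by apply: (integrableS measurableT) => //; exact: integrable_indic.
rewrite RintegralD //; last exact: (integrableZl mA (-1) (int Minus)).
rewrite RintegralZl // mulN1r; congr (_ - _);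
  by rewrite /Rintegral integral_indic // setIC.
Qed.

(** The evolution at [u] multiplies the difference of the two occupied weights by [expR (- (2 * t))]
    and preserves the total weight. *)
Lemma cond_magnetization z n u (D : {fset V}) : D =i tree_ball E n u ->
  cond_mean mut (magnetization u) (agree (D `\ u)%fset z) =
  expR (- (2 * t)) * (root_weight z n u Plus - root_weight z n u Minus) /
  (root_weight z n u Plus + root_weight z n u Minus + root_weight z n u Zero).
Proof.
move=> Db; have mA := @measurable_agree V (D `\ u)%fset z.
rewrite /cond_mean Rintegral_magnetization // -[fine _]/(pr mut _).
rewrite (pr_split mut u mA) big_spin /= !(pr_mut_ball _ _ Db) !big_spin /=.
have pp := @p_site_same R t Plus isT; have mm := @p_site_same R t Minus isT.
have pm := @p_site_opp R t Plus isT; have mp := @p_site_opp R t Minus isT.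
rewrite /= in pm mp.
rewrite pp mm pm mp !p_site_zero !p_zero_site /=.
by congr (_ / _); field.
Qed.

(** The weight of a vacant root must not swamp the magnetization. Comparing the rows [Zero] and
    [Plus] of the transition matrices gives a constant independent of the boundary condition and the
    radius; [C k] dominates every entrywise ratio. *)
Lemma vacant_bound u : exists2 K : R, 0 <= K & forall z n,
  root_weight z n u Zero <= K * root_weight z n u Plus.
Proof.
pose C k : R := \sum_(c : spin) trans mu u k Zero c / trans mu u k Plus c.
have trC k c : adj E u k -> trans mu u k Zero c <= C k * trans mu u k Plus c.
  move=> uk; rewrite -ler_pdivrMr ?tr_gt0 // /C (bigD1 c) //= lerDl.
  by apply: sumr_ge0 => c' _; rewrite divr_ge0 // ltW ?tr_gt0.
have pP := pr_at_gt0 cayleyE la_gt0 gibbs_mu u Plus.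
have p0 := pr_at_gt0 cayleyE la_gt0 gibbs_mu u Zero.
have C0 : 0 <= \prod_(k <- nbr E u) C k.
  rewrite big_seq prodr_ge0 // => k; rewrite (mem_nbr cayleyE) => uk.
  by apply: sumr_ge0 => c _; rewrite divr_ge0 // ltW ?tr_gt0.
exists (pr mu (at_ u Zero) / pr mu (at_ u Plus) * \prod_(k <- nbr E u) C k).
  by rewrite mulr_ge0 // divr_ge0 ?pr_ge0.
move=> z n; rewrite /root_weight.
have -> : pr mu (at_ u Zero) / pr mu (at_ u Plus) * \prod_(k <- nbr E u) C k *
    (pr mu (at_ u Plus) * \prod_(k <- nbr E u) branch z n u k Plus) =
  pr mu (at_ u Zero) *
    (\prod_(k <- nbr E u) C k * \prod_(k <- nbr E u) branch z n u k Plus).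
  by field; rewrite gt_eqF.
rewrite ler_pM2l // -big_split /= big_seq [leRHS]big_seq; apply: ler_prod => k.
rewrite (mem_nbr cayleyE) => uk.
rewrite ltW ?(branch_gt0 cayleyE t_ge1 tr_gt0) //= mulr_sumr.
apply: ler_sum => c _; rewrite mulrA ler_wpM2r ?trC //.
exact: (msg_ge0 cayleyE t_ge1 tr_gt0).
Qed.

(** Beyond any large ball, annuli of pure [Plus] and of pure [Minus] force magnetizations at [u]
    whose gap does not depend on the ball. *)
Lemma bad_of_good eta i u : adj E i u -> ~ fail_ever E i u eta -> bad mut eta.
Proof.
move=> iu good; have ngood n : ~ fail E n i u eta.
  by move=> fn; apply: good; exists n.
exists (magnetization u), [fset u]%fset; split.
  apply/localP; exists [fset u]%fset => w w' ww'.
  have wu : w u = w' u by apply: ww'; rewrite inE.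
  have memu s : (w \in at_ u s) = (w' \in at_ u s).
    by apply/idP/idP => /set_mem h; apply/mem_set; move: h; rewrite /at_ /= wu.
  by rewrite /magnetization !indicE !memu.
apply/limsup_gt0 => set.
have [m rm] := exists_reach X t_ge1.
have [K K0 HK] := vacant_bound u.
pose q := expR (- (2 * t)); have q0 : 0 < q by exact: expR_gt0.
have K3 : 0 < 3 + 2 * K by lra.
(* Half of the gap between the two conditional magnetizations, see [h1] and [h2]. *)
have del0 : 0 < q / (3 + 2 * K) / 2 by rewrite !divr_gt0.
have [L1 HL1] := set _ del0.
have [n L1n] := tree_ball_cofinal cayleyE L1 u.
pose L := [fset x in tree_ball E n u]%fset.
(* The ball [L] shows [eta]; the [m + 1] further levels up to [D] carry the boundary condition. *)
pose N := (n + m).+1.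
pose D := [fset x in tree_ball E N u]%fset.
have Lb : L =i tree_ball E n u by move=> x; rewrite !inE.
have Db : D =i tree_ball E N u by move=> x; rewrite !inE.
have LD : (L `<=` D)%fset.
  apply/fsubsetP => v; rewrite Lb Db; apply: tree_ball_sub.
  by rewrite /N -addnS leq_addr.
have L1L : (L1 `<=` L)%fset by apply/fsubsetP => v /L1n; rewrite Lb.
have uL : u \in L by rewrite Lb mem_head.
have uD : u \in D by rewrite Db mem_head.
have setE : ((L `\` [fset u]) `|` (D `\` L))%fset = (D `\ u)%fset.
  apply/fsetP => v; rewrite !in_fsetU !in_fsetD !in_fset1.
  have [vL|vL] := boolP (v \in L); first by rewrite (fsubsetP LD) //= orbF.
  by have [vu|] := eqVneq v u; [rewrite vu uL in vL|].
pose z tau := splice L eta (fun=> tau).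
have ratio tau : tau != Zero ->
    2 * root_weight (z tau) N u (spin_opp tau) <= root_weight (z tau) N u tau.
  move=> tau0; rewrite /root_weight (pr_at_flip flip_mu) mulrCA ler_pM2l; last first.
    exact: (pr_at_gt0 cayleyE la_gt0 gibbs_mu).
  apply: (root_ratio (eta := eta) cayleyE d_ge4 t_ge1 X_ge16 tr_gt0 tr_flip
    tr_cross iu tau0 rm (ngood n.+1)).
  move=> k; rewrite (mem_children cayleyE) => /andP[uk ki].
  have kN : k \in nbr E u by rewrite (mem_nbr cayleyE).
  split=> [v vk|v vk nvk]; rewrite /z /splice.
    rewrite Lb ifT // in_cons; apply/orP; right; apply/flatten_mapP.
    by exists k.
  case: ifP => // vL; case/negP: nvk.
  by rewrite Lb in vL; exact: (level_flatten cayleyE (r := nbr E u) _ kN vk vL).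
have := HL1 L L1L (fun=> Plus) (fun=> Minus) D LD.
rewrite /cond_mean_at setE -![splice L eta _]/(z _) !(cond_magnetization _ Db).
have := ratio Plus isT; have := ratio Minus isT; rewrite /= -/q.
have := HK (z Plus) N.
have := root_weight_gt0 (z Minus) N u; have := root_weight_gt0 (z Plus) N u.
set bp := root_weight (z Plus) N u Plus; set bm := root_weight (z Plus) N u Minus.
set b0 := root_weight (z Plus) N u Zero; set ap := root_weight (z Minus) N u Plus.
set am := root_weight (z Minus) N u Minus; set a0 := root_weight (z Minus) N u Zero.
move=> b_gt0 a_gt0 Kb ra rb.
have bp_gt0 : 0 < bp := b_gt0 Plus; have bm_gt0 : 0 < bm := b_gt0 Minus.
have b0_gt0 : 0 < b0 := b_gt0 Zero; have ap_gt0 : 0 < ap := a_gt0 Plus.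
have am_gt0 : 0 < am := a_gt0 Minus; have a0_gt0 : 0 < a0 := a_gt0 Zero.
(* Since bm <= bp / 2 and b0 <= K bp, the numerator is at least q bp / 2 and the denominator at most
   (3/2 + K) bp. *)
have h1 : q / (3 + 2 * K) <= q * (bp - bm) / (bp + bm + b0).
  rewrite -mulrA ler_pM2l // ler_pdivlMr; last lra.
  rewrite mulrC ler_pdivrMr //.
  have : 0 <= K * (bp - 2 * bm) by rewrite mulr_ge0 // subr_ge0.
  nra.
have h2 : q * (ap - am) / (ap + am + a0) <= 0.
  rewrite ler_pdivrMr; last lra.
  by rewrite mul0r pmulr_rle0 //; lra.
have h3 : 0 < q / (3 + 2 * K) by rewrite divr_gt0.
rewrite ger0_norm; last lra.
lra.
Qed.

(** If [eta] is not bad, no vertex is good and [fail_around n] occurs. That event concerns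
    occupation only, so the evolved and the initial measure give it the same probability. *)
Lemma pr_not_bad n : pr mut (~` [set eta : Omega V | bad mut eta]) <= 2^-1 ^+ n.
Proof.
have cV := countable_vertices cayleyE.
have mbad := measurable_bad mut cV.
have [i [j ij]] := exists_adj cayleyE.
have d1 : (1 < d)%N by exact: leq_trans d_ge4.
have mfail := F_measurable (F_fail_around cayleyE n ij).
have eps0 : 0 <= eps by rewrite divr_ge0 ?exprn_ge0 // ltW.
have eps_small : 4 * d%:R ^+ 2 * eps <= 1.
  by rewrite /eps mulrA ler_pdivrMr // mul1r.
have := pr_fail_around cayleyE zero_le eps0 eps_small n ij d1.
apply: le_trans.
rewrite -lee_fin -!prE //; last exact: measurableC.
rewrite -(mut_occupation evolved cV mfail (@occupation_fail_around _ _ _ _ _)).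
apply: le_measure; rewrite ?inE //; first exact: measurableC.
move=> eta nbad; apply: (fail_aroundP cayleyE d1) => // k l kl.
by apply: contrapT => good; apply: nbad; exact: bad_of_good good.
Qed.

Lemma mut_bad : mut [set eta : Omega V | bad mut eta] = 1%E.
Proof.
have mbad := measurable_bad mut (countable_vertices cayleyE).
have H := le_half_exprn_eq0 (pr_ge0 _ _) pr_not_bad.
rewrite prE //; congr EFin.
have := prU mut mbad (measurableC mbad) (setICr _).
by rewrite setUv pr_setT H addr0.
Qed.

End Discontinuity.

Theorem theorem2p6 (R : realType) (d : nat) (d_ge4 : (4 <= d)%N) :
  exists beta_b lambda_b : R, [/\ 0 < beta_b, 0 < lambda_b &
    forall beta : R, beta_b < beta -> exists2 t_b : R, 0 <= t_b &
      forall (V : choiceType) (E : set {fset V}), cayley_tree d E ->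
      forall t lambda : R, t_b <= t -> lambda_b <= lambda ->
      forall mu mut : probability (Omega V) R,
        intermediate E beta lambda mu -> time_evolved t mu mut ->
        measurable [set eta : Omega V | bad mut eta] /\
        mut [set eta : Omega V | bad mut eta] = 1%E].
Proof.
(* For [beta > 16], e^beta >= 1 + beta exceeds the threshold 16 of the contraction. The activity
   bound says 4 d^2 [eps] <= 1 for [eps] = 2^d / lambda, and time 1 keeps the field ratio at most
   2. *)
exists 16, (4 * d%:R ^+ 2 * 2 ^+ d); split=> //.
  by rewrite !mulr_gt0 ?exprn_gt0 // ltr0n (leq_trans _ d_ge4).
move=> beta beta16; exists 1 => // V E cayleyE t la t1 la1 mu mut.
move=> [gibbs_mu markov_mu _ flip_mu] evolved; split.
  exact: measurable_bad (countable_vertices cayleyE).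
exact: (mut_bad d_ge4 cayleyE beta16 t1 la1 gibbs_mu markov_mu flip_mu evolved).
Qed.
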